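(* Let $\{(X^{(k)},Y^{(k)},\Lambda^{(k)})\}_{k\ge 1}$ be a sequence generated by the algorithm DASSP described in the context, and suppose the following hold, where $\delta\in(0,1)$ is the damping parameter and $c$ is a constant satisfying $c>2(1-\delta)(2-\delta)/\delta$: (A1) $f:\mathbb{S}^n\to\mathbb{R}$ is continuously differentiable and there is $L>0$ with $\|\nabla f(U)-\nabla f(V)\|_{\mathrm F}\le L\|U-V\|_{\mathrm F}$ for all $U,V\in\mathbb{S}^n$; (A2) there is $\gamma>0$ such that $\lambda_p(A^{(k)})-\lambda_{p+1}(A^{(k)})\ge\gamma$ for all $k\ge 0$; (A3) $\beta>2(L+1)$; (A4) the stepsizes are constant, $\eta_k\equiv\eta$, with $\eta\in(0,2/(\beta+L))$; (A5) $\tau\in\left(0,\ \frac{\delta}{2c}\min\left\{\frac1\beta\left(\frac1\eta-\frac{\beta+L}{2}\right),\frac{\gamma}{n}\right\}\right)$. Then $\{(X^{(k)},Y^{(k)},\Lambda^{(k)})\}$ has at least one accumulation point, and for each accumulation point $(X^\star,Y^\star,\Lambda^\star)$ there exist $\Sigma^\star\in\mathbb{S}^p$ and $\mu^\star=(\mu_1^\star,\ldots,\mu_m^\star)^\top\in\mathbb{R}^m$ such that $$\|F(X^\star,\mu^\star)X^\star-X^\star\Sigma^\star\|_{\mathrm F}\le \hat C_1\delta,\qquad \max_{1\le j\le m}\left|\mathrm{Tr}(X^{\star\top}W_jX^\star)-b_j\right|\le\hat C_2\delta,$$ where $$\hat C_1:=\frac{L\sqrt{p(n-p)}}{\tau\beta}\|\Lambda^\star\|_{\mathrm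 F},\qquad \hat C_2:=\frac{1}{\tau\beta}\|\Lambda^\star\|_{\mathrm F}\cdot\max_{1\le j\le m}\|W_j\|_{\mathrm F},\qquad F(X,\mu):=\nabla f(XX^\top)+\sum_{j=1}^m\mu_jW_j .$$
   Context: Notation: $\mathbb{S}^n$ is the space of real symmetric $n\times n$ matrices with Frobenius inner product $\langle A,B\rangle=\mathrm{Tr}(A^\top B)$ and norm $\|\cdot\|_{\mathrm F}$; eigenvalues are ordered $\lambda_1(A)\ge\cdots\ge\lambda_n(A)$; $\mathrm{St}_p(\mathbb{R}^n)=\{X\in\mathbb{R}^{n\times p}:X^\top X=I_p\}$, with $1\le p<n$. Problem: given $f:\mathbb{S}^n\to\mathbb{R}$, $W_1,\dots,W_m\in\mathbb{S}^n$ and $b_1,\dots,b_m\in\mathbb{R}$, $$\text{(P)}\quad \min_X f(XX^\top)\quad\text{s.t. } X\in\mathrm{St}_p(\mathbb{R}^n),\ \mathrm{Tr}(X^\top W_jX)=b_j,\ j=1,\dots,m.$$ Standing (blanket) assumption: (P) has a feasible point, and at every local minimizer $X$ of (P) the matrices $(I_n-XX^\top)W_jX$, $j=1,\dots,m$, are linearly independent. Let $\mathcal{Y}=\{Y\in\mathbb{S}^n:\mathrm{Tr}(W_jY)=b_j,\ j=1,\dots,m\}$ and $\mathcal{T}_{\mathcal{Y}}=\{Z\in\mathbb{S}^n:\mathrm{Tr}(W_jZ)=0,\ j=1,\dots,m\}$; $\mathrm{Proj}_{\mathcal{T}_{\mathcal{Y}}}$ is the orthogonal projection of $\mathbb{S}^n$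 onto $\mathcal{T}_{\mathcal{Y}}$. Algorithm DASSP: parameters $\beta>0$, $\tau\in(0,1]$, damping $\delta\in[0,1)$, stepsizes $\eta_k>0$; initial $Y^{(0)}\in\mathcal{Y}$ (if not in $\mathcal{Y}$ it is first replaced by its projection onto $\mathcal{Y}$) and $\Lambda^{(0)}\in\mathbb{S}^n$. For $k=0,1,2,\dots$: - $A^{(k)}:=Y^{(k)}+\frac{1-\delta}{\beta}\Lambda^{(k)}$ and $X^{(k+1)}$ is a minimizer of $-\mathrm{Tr}(X^\top A^{(k)}X)$ over $X\in\mathrm{St}_p(\mathbb{R}^n)$; - $Y^{(k+1)}:=Y^{(k)}-\eta_k\,\mathrm{Proj}_{\mathcal{T}_{\mathcal{Y}}}\left(\nabla f(Y^{(k)})+(1-\delta)\Lambda^{(k)}+\beta(Y^{(k)}-X^{(k+1)}(X^{(k+1)})^\top)\right)$; - $\Lambda^{(k+1)}:=(1-\delta)\Lambda^{(k)}+\tau\beta\left(Y^{(k+1)}-X^{(k+1)}(X^{(k+1)})^\top\right)$. The algorithm is run without stopping, producing an infinite sequence. *)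

(* Defs.v *)
From HB Require Import structures.
From mathcomp Require Import all_boot all_order all_algebra.
From mathcomp Require Import all_classical all_reals all_analysis.

Set Implicit Arguments.
Unset Strict Implicit.
Unset Printing Implicit Defensive.

Import Order.TTheory GRing.Theory Num.Theory.
Import numFieldNormedType.Exports.

Local Open Scope classical_set_scope.
Local Open Scope ring_scope.

(* A real symmetric matrix is a square matrix [A] with [A \is symmetricmx].
   A function on symmetric matrices is represented by a function on all square
   matrices, of which only the values at symmetric arguments are ever used. *)

Section Frobenius.
Variables (R : realType) (m n : nat).

Definition frob_dot (A B : 'M[R]_(m, n)) : R := \tr (A^T *m B).

Definition frob_norm (A : 'M[R]_(m, n)) : R := Num.sqrt (frob_dot A A).

End Frobenius.

Section SymmetricMatrices.
Variables (R : realType) (n : nat).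
Implicit Types (A B Y Z G H : 'M[R]_n) (f : 'M[R]_n -> R).

Definition sym_set : set 'M[R]_n := [set A | A \is symmetricmx].

(* The eigenvalues of [A] with multiplicity, in nonincreasing order.  For
   symmetric [A] exactly one such sequence exists, and it has size [n]. *)
Definition eigenvalues A : seq R :=
  xget [::] [set s : seq R | sorted (fun x y => y <= x) s
                             /\ char_poly A = \prod_(x <- s) ('X - x%:P)].

(* Numbered from 1: [lambda 1 A] is the largest eigenvalue. *)
Definition lambda (i : nat) A : R := nth 0 (eigenvalues A) i.-1.

(* Frechet gradient relative to the space of symmetric matrices: both the
   gradient and the increments are symmetric. *)
Definition is_gradient f Y G : Prop :=
  G \is symmetricmx /\
  forall e : R, 0 < e -> exists2 d : R, 0 < d &
    forall H, H \is symmetricmx -> frob_norm H <= d ->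
      `|f (Y + H) - f Y - frob_dot G H| <= e * frob_norm H.

Definition gradient f Y : 'M[R]_n := xget 0 [set G | is_gradient f Y G].

Definition continuously_differentiable f : Prop :=
  (forall Y, Y \is symmetricmx -> exists G, is_gradient f Y G) /\
  {within sym_set, continuous (gradient f)}.

Definition gradient_lipschitz (L : R) f : Prop :=
  forall U V, U \is symmetricmx -> V \is symmetricmx ->
    frob_norm (gradient f U - gradient f V) <= L * frob_norm (U - V).

End SymmetricMatrices.

Section Problem.
Variables (R : realType) (n p m : nat).
Variables (f : 'M[R]_n -> R) (W : 'I_m -> 'M[R]_n) (b : 'I_m -> R).

Definition stiefel : set 'M[R]_(n, p) := [set X | X^T *m X = 1%:M].

Definition feasible : set 'M[R]_(n, p) :=
  [set X | stiefel X /\ forall j, \tr (X^T *m W j *m X) = b j].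

Definition local_minimizer (X : 'M[R]_(n, p)) : Prop :=
  feasible X /\
  \forall X' \near X, feasible X' -> f (X *m X^T) <= f (X' *m X'^T).

Definition standing_assumption : Prop :=
  (exists X, feasible X) /\
  forall X, local_minimizer X ->
    free [seq (1%:M - X *m X^T) *m W j *m X | j : 'I_m].

Definition affine_set : set 'M[R]_n :=
  [set Y | Y \is symmetricmx /\ forall j, \tr (W j *m Y) = b j].

Definition tangent_set : set 'M[R]_n :=
  [set Z | Z \is symmetricmx /\ forall j, \tr (W j *m Z) = 0].

(* Orthogonal projection of the space of symmetric matrices onto its subspace
   [tangent_set]; meaningful for symmetric [A]. *)
Definition proj_tangent (A : 'M[R]_n) : 'M[R]_n :=
  xget 0 [set P | tangent_set P /\
                  forall Z, tangent_set Z -> frob_dot (A - P) Z = 0].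

Definition F_mx (X : 'M[R]_(n, p)) (mu : 'cV[R]_m) : 'M[R]_n :=
  gradient f (X *m X^T) + \sum_(j < m) mu j 0 *: W j.

Definition A_mx (beta delta : R) (Y Lam : nat -> 'M[R]_n) (k : nat) : 'M[R]_n :=
  Y k + ((1 - delta) / beta) *: Lam k.

(* The iterate [X 0] is never used: the first one is [X 1]. *)
Record DASSP (beta tau delta : R) (eta : nat -> R)
    (X : nat -> 'M[R]_(n, p)) (Y Lam : nat -> 'M[R]_n) : Prop := {
  dassp_beta : 0 < beta;
  dassp_tau : 0 < tau <= 1;
  dassp_delta : 0 <= delta < 1;
  dassp_eta : forall k, 0 < eta k;
  dassp_Y0 : affine_set (Y 0%N);
  dassp_Lam0 : Lam 0%N \is symmetricmx;
  dassp_X : forall k,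
    stiefel (X k.+1) /\
    forall X', stiefel X' ->
      - \tr ((X k.+1)^T *m A_mx beta delta Y Lam k *m X k.+1)
      <= - \tr (X'^T *m A_mx beta delta Y Lam k *m X');
  dassp_Y : forall k,
    Y k.+1 = Y k - eta k *: proj_tangent
      (gradient f (Y k) + (1 - delta) *: Lam k
       + beta *: (Y k - X k.+1 *m (X k.+1)^T));
  dassp_Lam : forall k,
    Lam k.+1 = (1 - delta) *: Lam k
               + (tau * beta) *: (Y k.+1 - X k.+1 *m (X k.+1)^T)
}.

Definition accumulation_point (X : nat -> 'M[R]_(n, p)) (Y Lam : nat -> 'M[R]_n)
    (Xs : 'M[R]_(n, p)) (Ys Lams : 'M[R]_n) : Prop :=
  cluster ((fun k => (X k.+1, Y k.+1, Lam k.+1)) @ \oo) (Xs, Ys, Lams).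

Definition C1_hat (L tau beta : R) (Lams : 'M[R]_n) : R :=
  L * Num.sqrt (p * (n - p))%:R / (tau * beta) * frob_norm Lams.

Definition C2_hat (tau beta : R) (Lams : 'M[R]_n) : R :=
  1 / (tau * beta) * frob_norm Lams
  * \big[Num.max/0]_(j < m) frob_norm (W j).

End Problem.

(* Main.v *)
Require Import Defs.
From HB Require Import structures.
From mathcomp Require Import all_boot all_order all_algebra.
From mathcomp Require Import all_classical all_reals all_analysis.
From mathcomp Require Import fingroup perm complex ring lra.

Set Implicit Arguments.
Unset Strict Implicit.
Unset Printing Implicit Defensive.

Import Order.TTheory GRing.Theory Num.Theory.
Import numFieldNormedType.Exports.

Local Open Scope classical_set_scope.
Local Open Scope ring_scope.

(* Let P_k = X_k X_k^T.  The damped augmented Lagrangian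
     f(Y) + (1 - delta) <Lam, Y - P> + beta/2 |Y - P|^2,
   corrected by a negative multiple of |Lam_k|^2 and a positive multiple of
   |Lam_k - Lam_(k-1)|^2, decreases along the iterations: the X-step gains
   |P_(k+1) - P_k|^2 by the eigenvalue gap, the Y-step gains |Y_(k+1) - Y_k|^2
   by the descent lemma, and for small tau these gains dominate the increase of
   the multiplier step.  It is coercive because beta > L, so the iterates are
   bounded and their successive differences vanish.  At an accumulation point
   this gives delta Lam = tau beta (Y - P), the matrix A = Y + (1 - delta)/beta Lam
   commutes with P, and grad f(Y) + (1 - delta) Lam + beta (Y - P) is a
   combination of the W_j.  Multiplying the latter by X leaves the residual
   (grad f(P) - grad f(Y)) X, which the Lipschitz bound controls. *)

(** * The Frobenius inner product and norm *)

Section FrobeniusTheory.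
Variables (R : realType) (m n : nat).
Implicit Types (A B C : 'M[R]_(m, n)) (a : R).

Lemma frob_dotE A B : frob_dot A B = \sum_i \sum_j A i j * B i j.
Proof.
rewrite /frob_dot /mxtrace exchange_big /=; apply: eq_bigr => j _.
by rewrite mxE; apply: eq_bigr => i _; rewrite !mxE.
Qed.

Lemma frob_dotC A B : frob_dot A B = frob_dot B A.
Proof.
by rewrite !frob_dotE; do 2!apply: eq_bigr => ? _; rewrite mulrC.
Qed.

Lemma frob_dotDr A B C : frob_dot A (B + C) = frob_dot A B + frob_dot A C.
Proof. by rewrite /frob_dot mulmxDr mxtraceD. Qed.

Lemma frob_dotZr a A B : frob_dot A (a *: B) = a * frob_dot A B.
Proof. by rewrite /frob_dot -scalemxAr mxtraceZ. Qed.

Lemma frob_dotDl A B C : frob_dot (A + B) C = frob_dot A C + frob_dot B C.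
Proof. by rewrite frob_dotC frob_dotDr !(frob_dotC C). Qed.

Lemma frob_dotZl a A B : frob_dot (a *: A) B = a * frob_dot A B.
Proof. by rewrite frob_dotC frob_dotZr frob_dotC. Qed.

Lemma frob_dotNr A B : frob_dot A (- B) = - frob_dot A B.
Proof. by rewrite -scaleN1r frob_dotZr mulN1r. Qed.

Lemma frob_dotNl A B : frob_dot (- A) B = - frob_dot A B.
Proof. by rewrite frob_dotC frob_dotNr frob_dotC. Qed.

Lemma frob_dot0r A : frob_dot A 0 = 0.
Proof. by rewrite /frob_dot mulmx0 mxtrace0. Qed.

Lemma frob_dot_suml (I : finType) (F : I -> 'M[R]_(m, n)) B :
  frob_dot (\sum_i F i) B = \sum_i frob_dot (F i) B.
Proof.
by rewrite /frob_dot raddf_sum mulmx_suml (raddf_sum (@mxtrace R n)).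
Qed.

Lemma frob_dot_ge0 A : 0 <= frob_dot A A.
Proof.
by rewrite frob_dotE; do 2!(apply: sumr_ge0 => ? _); rewrite -expr2 sqr_ge0.
Qed.

Lemma sqr_entry_le A i j : A i j ^+ 2 <= frob_dot A A.
Proof.
rewrite frob_dotE (bigD1 i) //= (bigD1 j) //= expr2 -addrA lerDl.
by rewrite addr_ge0 // ?sumr_ge0 // => ? _; rewrite ?sumr_ge0 // => *;
  rewrite -expr2 sqr_ge0.
Qed.

Lemma frob_dot_eq0 A : frob_dot A A = 0 -> A = 0.
Proof.
move=> A0; apply/matrixP => i j; rewrite mxE; apply/eqP.
by rewrite -sqrf_eq0 eq_le sqr_ge0 andbT -A0 sqr_entry_le.
Qed.

Lemma frob_norm_ge0 A : 0 <= frob_norm A.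
Proof. exact: sqrtr_ge0. Qed.

Lemma sqr_frob_norm A : frob_norm A ^+ 2 = frob_dot A A.
Proof. by rewrite sqr_sqrtr // frob_dot_ge0. Qed.

Lemma frob_norm0 : frob_norm (0 : 'M[R]_(m, n)) = 0.
Proof. by rewrite /frob_norm frob_dot0r sqrtr0. Qed.

Lemma frob_normZ a A : frob_norm (a *: A) = `|a| * frob_norm A.
Proof.
by rewrite /frob_norm frob_dotZr frob_dotZl mulrA -expr2 sqrtrM ?sqr_ge0 //
           sqrtr_sqr.
Qed.

Lemma frob_normN A : frob_norm (- A) = frob_norm A.
Proof. by rewrite -scaleN1r frob_normZ normrN1 mul1r. Qed.

Lemma entry_le_frob_norm A i j : `|A i j| <= frob_norm A.
Proof.
rewrite -(@ler_pXn2r _ 2) ?nnegrE ?frob_norm_ge0 //.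
by rewrite sqr_frob_norm real_normK ?num_real // sqr_entry_le.
Qed.

(** Cauchy-Schwarz, from expanding the square of [|B| A - |A| B]. *)
Lemma frob_dot_le_norm A B : frob_dot A B <= frob_norm A * frob_norm B.
Proof.
have [->|A0] := eqVneq A 0; first by rewrite frob_dotC frob_dot0r frob_norm0 mul0r.
have [->|B0] := eqVneq B 0; first by rewrite frob_dot0r frob_norm0 mulr0.
have norm_gt0 C : C != 0 -> 0 < frob_norm C.
  rewrite lt_def frob_norm_ge0 andbT => C0; apply: contra_neq C0 => nC.
  by apply: frob_dot_eq0; rewrite -sqr_frob_norm nC expr0n.
have := frob_dot_ge0 (frob_norm B *: A - frob_norm A *: B).
rewrite !(frob_dotDl, frob_dotDr, frob_dotNl, frob_dotNr, frob_dotZl, frob_dotZr).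
rewrite (frob_dotC B A) -!sqr_frob_norm.
have := norm_gt0 _ A0; have := norm_gt0 _ B0.
move: (frob_norm A) (frob_norm B) (frob_dot A B) => x y z y0 x0 h.
have xy0 : 0 < x * y by exact: mulr_gt0.
rewrite -(ler_pM2l xy0); nra.
Qed.

Lemma frob_dot_norm_le A B : `|frob_dot A B| <= frob_norm A * frob_norm B.
Proof.
rewrite ler_norml frob_dot_le_norm andbT lerNl -frob_dotNl.
by rewrite -(frob_normN A) frob_dot_le_norm.
Qed.

Lemma frob_norm_triangle A B : frob_norm (A + B) <= frob_norm A + frob_norm B.
Proof.
rewrite -(@ler_pXn2r _ 2) ?nnegrE ?addr_ge0 ?frob_norm_ge0 //.
rewrite sqr_frob_norm frob_dotDl !frob_dotDr (frob_dotC B A).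
rewrite sqrrD !sqr_frob_norm; have := frob_dot_le_norm A B; lra.
Qed.

End FrobeniusTheory.

Definition frob_lin :=
  (frob_dotDl, frob_dotDr, frob_dotNl, frob_dotNr, frob_dotZl, frob_dotZr).

(** * Closure properties of symmetric matrices *)

Section Symmetric.
Variables (R : realType) (n : nat).
Implicit Types A B : 'M[R]_n.

Lemma symmetricmxE A : (A \is symmetricmx) = (A^T == A).
Proof. by rewrite qualifE /= expr0 scale1r map_mx_id // eq_sym. Qed.

Lemma sym_trmx A : A \is symmetricmx -> A^T = A.
Proof. by rewrite symmetricmxE => /eqP. Qed.

Lemma symD A B : A \is symmetricmx -> B \is symmetricmx ->
  A + B \is symmetricmx.
Proof. by rewrite !symmetricmxE raddfD /= => /eqP-> /eqP->. Qed.

Lemma symZ a A : A \is symmetricmx -> a *: A \is symmetricmx.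
Proof. by rewrite !symmetricmxE linearZ /= => /eqP->. Qed.

Lemma symB A B : A \is symmetricmx -> B \is symmetricmx ->
  A - B \is symmetricmx.
Proof. by move=> sA sB; rewrite -scaleN1r symD ?symZ. Qed.

Lemma sym0 : (0 : 'M[R]_n) \is symmetricmx.
Proof. by rewrite symmetricmxE trmx0. Qed.

Lemma sym_sum (I : finType) (F : I -> 'M[R]_n) :
  (forall i, F i \is symmetricmx) -> \sum_i F i \is symmetricmx.
Proof. by move=> sF; elim/big_ind: _ => //; [exact: sym0 | exact: symD]. Qed.

End Symmetric.

(** * Projectors [X X^T] with [X] on the Stiefel manifold *)

Section Stiefel.
Variables (R : realType) (n p : nat).
Implicit Types (X : 'M[R]_(n, p)) (A B : 'M[R]_n).

Lemma frob_dot_gram A X : frob_dot A (X *m X^T) = \tr (X^T *m A^T *m X).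
Proof. by rewrite /frob_dot mulmxA mxtrace_mulC mulmxA. Qed.

Lemma gram_sym X : X *m X^T \is symmetricmx.
Proof. by rewrite symmetricmxE trmx_mul trmxK. Qed.

Lemma stiefel_frob_dot X : stiefel X -> frob_dot (X *m X^T) (X *m X^T) = p%:R.
Proof.
move=> sX; rewrite frob_dot_gram trmx_mul trmxK !mulmxA sX mul1mx sX.
by rewrite mxtrace1.
Qed.

(** Since [P] is symmetric and idempotent, [P i i] is the sum of the squares of row [i], hence at
    least [P i i ^+ 2]. *)
Lemma stiefel_diag_le1 X i : stiefel X -> 0 <= (X *m X^T) i i <= 1.
Proof.
move=> sX; set P := X *m X^T.
have PP : P *m P = P by rewrite /P mulmxA -(mulmxA X) sX mulmx1.
have PT : P^T = P by rewrite /P trmx_mul trmxK.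
have Psym j : P j i = P i j by rewrite -{1}PT mxE.
have Pii : P i i = \sum_j P i j ^+ 2.
  by rewrite -{1}PP mxE; apply: eq_bigr => j _; rewrite Psym expr2.
have : P i i ^+ 2 <= P i i.
  rewrite {2}Pii (bigD1 i) //= lerDl sumr_ge0 // => *; exact: sqr_ge0.
have : 0 <= P i i by rewrite Pii sumr_ge0 // => *; exact: sqr_ge0.
by move: (P i i) => x; nra.
Qed.

(** Pythagoras: [A] is the orthogonal sum of [A X X^T], whose norm is that of [A X], and the
    remainder [B]. *)
Lemma frob_norm_mul_stiefel A X : stiefel X -> frob_norm (A *m X) <= frob_norm A.
Proof.
move=> sX; rewrite /frob_norm ler_sqrt ?frob_dot_ge0 //.
set B := A - A *m X *m X^T.
have AB : A = B + A *m X *m X^T by rewrite /B subrK.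
have BX0 : B *m X = 0.
  by rewrite /B mulmxBl -!mulmxA sX mulmx1 subrr.
have orth : frob_dot B (A *m X *m X^T) = 0.
  rewrite frob_dotC /frob_dot trmx_mul trmxK mxtrace_mulC mulmxA BX0 mul0mx.
  exact: mxtrace0.
have eqn : frob_dot (A *m X *m X^T) (A *m X *m X^T) = frob_dot (A *m X) (A *m X).
  move: (A *m X) => M; rewrite /frob_dot trmx_mul trmxK mxtrace_mulC.
  by rewrite mulmxA -(mulmxA M) sX mulmx1 mxtrace_mulC.
rewrite {3 4}AB; clearbody B; rewrite !frob_lin (frob_dotC _ B) orth eqn.
by have := frob_dot_ge0 B; lra.
Qed.

End Stiefel.

(** * The spectral theorem for real symmetric matrices *)

Section RealSpectral.
Variable R : realType.

(** Over the complex numbers the matrix is Hermitian, so its spectral diagonal is real. Its first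
    entry is then a real root of the characteristic polynomial, and therefore an eigenvalue over
    [R]. *)
Lemma symmetric_eigenvector n (A : 'M[R]_n.+1) : A \is symmetricmx ->
  exists a, exists2 v : 'rV[R]_n.+1, v != 0 & v *m A = a *: v.
Proof.
move=> symA; pose toC := real_complex R; pose AC := map_mx toC A.
have hermAC : AC \is hermsymmx.
  apply: realsym_hermsym.
    by rewrite qualifE /= expr0 scale1r map_mx_id // /AC map_trmx sym_trmx.
  by apply/mxOverP => i j; rewrite mxE; apply/complex_realP; exists (A i j).
have /mxOverP/(_ 0 0) := hermitian_spectral_diag_real hermAC.
move/complex_realP => [a da].
have /orthomx_spectralP AE := hermitian_normalmx hermAC.
have rootA : root (char_poly A) a.
  rewrite -(fmorph_root toC) map_char_poly -eigenvalue_root_char.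
  apply/eigenvalueP; exists (row 0 (spectralmx AC)).
    have SA : spectralmx AC *m AC = diag_mx (spectral_diag AC) *m spectralmx AC.
      by rewrite {2}AE !mulmxA mulmxV ?spectral_unit // mul1mx.
    rewrite -row_mul SA.
    by apply/rowP => j; rewrite mul_diag_mx !mxE da.
  apply/eqP => r0; have := spectral_unit AC.
  rewrite -row_free_unit => /row_freeP[B PB].
  have /rowP/(_ 0) : row 0 (1%:M : 'M[R[i]]_n.+1) = 0.
    by rewrite -PB row_mul r0 mul0mx.
  by rewrite !mxE /= => /eqP; rewrite oner_eq0.
have /eigenvalueP[v vA v0] : eigenvalue A a by rewrite eigenvalue_root_char.
by exists a, v.
Qed.

(* The Householder reflection exchanging [e_0] and the unit vector [u]. *)
Lemma orthogonal_first_row n (u : 'rV[R]_n.+1) : u *m u^T = 1%:M ->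
  exists H : 'M[R]_n.+1, [/\ H^T = H, H *m H = 1%:M & row 0 H = u].
Proof.
move=> uu; pose e : 'rV[R]_n.+1 := row 0 1%:M.
have ee : e *m e^T = 1%:M.
  by rewrite /e -row_mul mul1mx; apply/matrixP => i j; rewrite !mxE !ord1.
pose c := (e *m u^T) 0 0; pose w := u - e.
have eu : e *m u^T = c%:M by exact: mx11_scalar.
have ue : u *m e^T = c%:M by rewrite -(trmxK u) -trmx_mul eu tr_scalar_mx.
have ww : w *m w^T = (2 - 2 * c)%:M.
  rewrite /w linearB /= mulmxBl !mulmxBr uu eu ue ee -!raddfB /=.
  by congr (_%:M); ring.
have ew : e *m w^T = (c - 1)%:M.
  by rewrite /w linearB /= mulmxBr eu ee -raddfB.
have [c1|c1] := eqVneq c 1.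
  exists 1%:M; split; rewrite ?trmx1 ?mulmx1 //.
  apply/esym/eqP; rewrite -subr_eq0 -/e -/w; apply/eqP.
  apply: frob_dot_eq0; rewrite /frob_dot mxtrace_mulC ww c1.
  by rewrite mulr1 subrr mxtrace_scalar mul0rn.
have c1' : 2 - 2 * c != 0.
  by rewrite -[X in X - _]mulr1 -mulrBr mulf_neq0 ?pnatr_eq0 // subr_eq0 eq_sym.
(* As [w w^T = 2 - 2 c], this is the reflection factor [2 / |w|^2]; the case [c = 1], where [w = 0],
   is settled above. *)
pose s := (1 - c)^-1; exists (1%:M - s *: (w^T *m w)).
have es : s * (2 - 2 * c) = 2.
  rewrite /s; field; move: c1; apply: contra_neq => h; lra.
have uE : e + w = u by rewrite addrC subrK.
clearbody w; pose S := s *: (w^T *m w).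
have SS : S *m S = S *+ 2.
  rewrite /S -scalemxAl -scalemxAr mulmxA -(mulmxA w^T w) ww mul_mx_scalar.
  by rewrite -scalemxAl scalerA es -scaler_nat scalerA mulrC -scalerA scaler_nat.
have eS : e *m S = - w.
  rewrite /S -scalemxAr mulmxA ew mul_scalar_mx scalerA -[RHS]scaleN1r.
  by congr (_ *: _); rewrite /s; field; rewrite subr_eq0 eq_sym.
have ST : S^T = S by rewrite /S linearZ /= trmx_mul trmxK.
rewrite -/S; clearbody S; split.
- by rewrite linearB /= trmx1 ST.
- by rewrite mulmxBl mul1mx mulmxBr mulmx1 SS mulr2n opprB addrK subrK.
- by rewrite -[_ - _]mul1mx row_mul mulmxBr mulmx1 eS opprK.
Qed.

(** Deflation: a reflection [H] whose first row is a unit eigenvector turns [A] into [B = H A H]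
    with first row [a e_0]. By symmetry [B] is block diagonal, and the induction hypothesis applies
    to its lower right block. *)
Theorem real_spectral n (A : 'M[R]_n) : A \is symmetricmx ->
  exists (Q : 'M[R]_n) (d : 'rV[R]_n),
    Q *m Q^T = 1%:M /\ A = Q^T *m diag_mx d *m Q.
Proof.
elim: n A => [|n IH] A symA.
  by exists 1%:M, 0; split; apply/matrixP => [] [].
have [a [v v0 vA]] := symmetric_eigenvector symA.
have vv0 : 0 < frob_norm v.
  rewrite lt_def frob_norm_ge0 andbT; apply: contra_neq v0 => nv.
  by apply: frob_dot_eq0; rewrite -sqr_frob_norm nv expr0n.
pose u := (frob_norm v)^-1 *: v.
have uu : u *m u^T = 1%:M.
  rewrite /u linearZ /= -scalemxAl -scalemxAr scalerA.
  have -> : v *m v^T = (frob_norm v ^+ 2)%:M.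
    rewrite sqr_frob_norm /frob_dot mxtrace_mulC trace_mx11.
    exact: mx11_scalar.
  by rewrite -scalemx1 scalerA -expr2 -exprMn mulVf ?gt_eqF // expr1n scale1r.
have uA : u *m A = a *: u by rewrite /u -scalemxAl vA !scalerA mulrC.
have [H [HT HH Hu]] := orthogonal_first_row uu.
clearbody u.
pose B : 'M[R]_(1 + n) := H *m A *m H.
have BT : B^T = B by rewrite /B !trmx_mul HT sym_trmx // mulmxA.
have rB : row 0 B = a *: row 0 1%:M.
  by rewrite /B !row_mul Hu uA -scalemxAl -Hu -row_mul HH.
have AB : H *m B *m H = A by rewrite /B !mulmxA HH mul1mx -mulmxA HH mulmx1.
clearbody B; have [Q [d [QQ BQ]]] : exists (Q : 'M[R]_n) (d : 'rV[R]_n),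
    Q *m Q^T = 1%:M /\ drsubmx B = Q^T *m diag_mx d *m Q.
  by apply: IH; rewrite symmetricmxE -[X in X^T]/(drsubmx B) trmx_drsub BT.
pose K : 'M[R]_(1 + n) := block_mx 1%:M 0 0 Q.
pose D : 'rV[R]_(1 + n) := row_mx a%:M d.
have BE : B = K^T *m diag_mx D *m K.
  rewrite /K /D diag_mx_row tr_block_mx !mulmx_block.
  rewrite !trmx0 !(mulmx0, mul0mx, addr0, add0r) -BQ.
  rewrite trmx1 mul1mx mulmx1 -[LHS]submxK.
  have rB0 (i : 'I_1) j : B (lshift n i) j = a * (lshift n i == j)%:R.
    have -> : lshift n i = 0 by apply: val_inj; rewrite ord1.
    by have /rowP/(_ j) := rB; rewrite !mxE.
  have ur : ursubmx B = 0.
    by apply/matrixP => i j; rewrite !mxE rB0 eq_lrshift mulr0.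
  congr block_mx => //.
  - by apply/matrixP => i j; rewrite !mxE rB0 !ord1 eqxx mulr1 mulr1n.
  - by rewrite -[B]BT -trmx_ursub ur trmx0.
have KK : K *m K^T = 1%:M.
  rewrite /K tr_block_mx mulmx_block !trmx0 !(mulmx0, mul0mx, addr0, add0r).
  by rewrite trmx1 mulmx1 QQ -scalar_mx_block.
exists (K *m H), D; split.
  by rewrite trmx_mul HT mulmxA -(mulmxA K) HH mulmx1.
by rewrite trmx_mul HT !mulmxA -(mulmxA H) -(mulmxA H) -BE AB.
Qed.

End RealSpectral.

(** * Spectral decomposition with ordered eigenvalues *)

Section SortedSpectral.
Variable R : realType.

Lemma char_poly_orthogonal_diag n (Q : 'M[R]_n) (d : 'rV[R]_n) :
  Q *m Q^T = 1%:M ->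
  char_poly (Q^T *m diag_mx d *m Q) = \prod_(i < n) ('X - (d 0 i)%:P).
Proof.
move=> QQ; have QTQ : Q^T *m Q = 1%:M by exact: mulmx1C.
pose P := map_mx polyC Q.
have PP : P^T *m P = 1%:M by rewrite /P map_trmx -map_mxM QTQ map_mx1.
have -> : char_poly (Q^T *m diag_mx d *m Q) = char_poly (diag_mx d).
  rewrite /char_poly /char_poly_mx.
  have -> : 'X%:M - map_mx polyC (Q^T *m diag_mx d *m Q) =
    P^T *m ('X%:M - map_mx polyC (diag_mx d)) *m P.
    rewrite mulmxBr mulmxBl mul_mx_scalar -scalemxAl PP scalemx1.
    by rewrite !map_mxM map_trmx.
  by rewrite !det_mulmx mulrC mulrA -det_mulmx (mulmx1C PP) det1 mul1r.
rewrite char_poly_trig; last first.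
  apply/is_trig_mxP => i j ij; rewrite !mxE.
  by have /negPf-> : i != j by rewrite neq_ltn ij.
by apply: eq_bigr => i _; rewrite !mxE eqxx.
Qed.

(** Identifies the list chosen by [xget]: a split polynomial determines its roots up to permutation,
    and sorting removes that freedom. *)
Lemma eigenvalues_uniq n (A : 'M[R]_n) (s : seq R) :
  sorted (fun x y => y <= x) s -> char_poly A = \prod_(x <- s) ('X - x%:P) ->
  eigenvalues A = s.
Proof.
move=> sorted_s charA.
have [sorted_e charE] : [set s : seq R | sorted (fun x y => y <= x) s
    /\ char_poly A = \prod_(x <- s) ('X - x%:P)] (eigenvalues A).
  by apply: xgetPex; exists s.
apply: (sorted_eq _ _ sorted_e sorted_s).
- by move=> x y z yx zy; exact: le_trans zy yx.
- by move=> x y /andP[yx xy]; apply: le_anti; rewrite xy yx.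
- by apply: prod_XsubC_eq; rewrite -charE -charA.
Qed.

(** The permutation that sorts the diagonal is applied to the rows of [Q] as well. Ordinals start at
    0 and [lambda] at 1, hence [i.+1]. *)
Theorem sorted_spectral n (A : 'M[R]_n) : A \is symmetricmx ->
  exists (Q : 'M[R]_n) (d : 'rV[R]_n),
    [/\ Q *m Q^T = 1%:M, A = Q^T *m diag_mx d *m Q,
        forall i, d 0 i = lambda i.+1 A
      & forall i j : 'I_n, (i <= j)%N -> d 0 j <= d 0 i].
Proof.
move=> symA; have [Q [d [QQ AE]]] := real_spectral symA.
pose t := [tuple d 0 i | i < n].
pose ge := fun x y : R => y <= x.
have tot_ge : total ge by move=> x y; exact: ge_total.
have tr_ge : transitive ge by move=> x y z yx zy; exact: le_trans zy yx.
have : perm_eq (sort ge t) t by rewrite perm_sort.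
move=> /tuple_permP[s sE].
have sorted_t : sorted ge (sort ge t) by exact: sort_sorted.
have eigA : eigenvalues A = sort ge t.
  apply: eigenvalues_uniq => //; rewrite AE char_poly_orthogonal_diag //.
  rewrite (perm_big t) /=; last by rewrite perm_sort.
  by rewrite big_map enumT.
exists (row_perm s Q), (col_perm s d); split.
- rewrite row_permE trmx_mul mulmxA -(mulmxA (perm_mx s)) QQ mulmx1.
  by rewrite tr_perm_mx -perm_mxM mulgV perm_mx1.
- rewrite {1}AE; apply/matrixP => i j; rewrite !mul_mx_diag !mxE.
  rewrite (reindex_inj (@perm_inj _ s)) /=; apply: eq_bigr => k _.
  by rewrite !mxE.
- move=> i; rewrite /lambda /= eigA sE mxE.
  by rewrite (nth_map i) -?enumT ?size_enum_ord // nth_ord_enum tnth_mktuple.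
- move=> i j ij; have : ge (nth 0 (sort ge t) i) (nth 0 (sort ge t) j).
    apply: (sorted_leq_nth tr_ge) => //; first by move=> x; exact: lexx.
      by rewrite inE size_sort size_tuple.
    by rewrite inE size_sort size_tuple.
  by rewrite sE !(nth_map i) -?enumT ?size_enum_ord // !nth_ord_enum
             !tnth_mktuple !mxE.
Qed.

End SortedSpectral.

(** * Quadratic growth of the trace maximization under an eigenvalue gap *)

Section EigenvalueGap.
Variables (R : realType) (n p : nat).
Hypotheses (p_gt0 : (0 < p)%N) (p_lt_n : (p < n)%N).

Let E : 'M[R]_n := pid_mx p.

Lemma card_ord_lt : \sum_(i < n) ((i < p)%N)%:R = p%:R :> R.
Proof.
under eq_bigr do rewrite mulrb.
rewrite -big_mkcond /= -(big_ord_widen _ (fun=> 1)) ?(ltnW p_lt_n) //.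
by rewrite sumr_const card_ord.
Qed.

Lemma frob_dot_pid (B : 'M[R]_n) : frob_dot E B = \sum_(i < n) (i < p)%:R * B i i.
Proof.
rewrite frob_dotE; apply: eq_bigr => i _.
rewrite (bigD1 i) //= big1 ?addr0 => [|j ji]; first by rewrite !mxE eqxx.
by rewrite !mxE eq_sym val_eqE (negPf ji) mul0r.
Qed.

(* With [w i := (Z Z^T) i i], which lies in [0, 1] and sums to [p], the defect
   is [\sum_i d i (1_{i < p} - w i)]; it is bounded below termwise by replacing
   [d i] by [d (p - 1)] when [i < p] and by [d p] otherwise. *)
Lemma diag_trace_gap (d : 'rV[R]_n) (Z : 'M[R]_(n, p)) (i0 i1 : 'I_n) :
  (forall i j : 'I_n, (i <= j)%N -> d 0 j <= d 0 i) ->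
  val i0 = p.-1 -> val i1 = p -> stiefel Z ->
  \tr (Z^T *m diag_mx d *m Z)
    + (d 0 i0 - d 0 i1) / 2 * frob_dot (E - Z *m Z^T) (E - Z *m Z^T)
  <= frob_dot E (diag_mx d).
Proof.
move=> dmono i0E i1E sZ.
set P := Z *m Z^T; pose w i := P i i.
have w01 i : 0 <= w i <= 1 by exact: stiefel_diag_le1.
have PP : frob_dot P P = p%:R by exact: stiefel_frob_dot.
have wsum : \sum_i w i = p%:R.
  have -> : \sum_i w i = \tr P by [].
  by rewrite /P mxtrace_mulC sZ mxtrace1.
have EE : frob_dot E E = p%:R.
  rewrite frob_dot_pid -card_ord_lt; apply: eq_bigr => i _.
  by rewrite !mxE eqxx; case: (i < p)%N; rewrite ?mulr1 ?mul0r.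
have -> : \tr (Z^T *m diag_mx d *m Z) = \sum_i d 0 i * w i.
  rewrite mxtrace_mulC mulmxA -/P; apply: eq_bigr => i _.
  by rewrite mul_mx_diag mxE mulrC.
have -> : frob_dot E (diag_mx d) = \sum_(i < n) (i < p)%:R * d 0 i.
  by rewrite frob_dot_pid; apply: eq_bigr => i _; rewrite !mxE eqxx.
(* Both projectors have squared norm [p], so [|E - P|^2 = 2 (p - S)]. The number [p - S] is the
   weight missing from the first [p] coordinates and equally the weight carried by the others. *)
rewrite !frob_lin (frob_dotC P) EE PP frob_dot_pid.
set S := \sum_(i < n) (i < p)%:R * P i i.
have Sle : 0 <= p%:R - S.
  rewrite -wsum /S -sumrB sumr_ge0 // => i _; rewrite -/(w i).
  have /andP[wi0 _] := w01 i.
  by case: (i < p)%N; rewrite ?mul1r ?mul0r ?subrr ?subr0.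
have termwise (i : 'I_n) : d 0 i0 * ((i < p)%:R * (1 - w i))
    - d 0 i1 * ((1 - (i < p)%:R) * w i) <= d 0 i * ((i < p)%:R - w i).
  have /andP[wi0 wi1] := w01 i; case: (ltnP i p) => ip /=.
    have : d 0 i0 <= d 0 i by apply: dmono; rewrite i0E -ltnS prednK.
    by nra.
  have : d 0 i <= d 0 i1 by apply: dmono; rewrite i1E.
  by nra.
have := ler_sum (index_enum _) (fun i (_ : xpredT i) => termwise i).
rewrite sumrB -!mulr_sumr.
have -> : \sum_(i < n) (i < p)%:R * (1 - w i) = p%:R - S.
  by rewrite -card_ord_lt -sumrB; apply: eq_bigr => i _; rewrite mulrBr mulr1.
have -> : \sum_(i < n) (1 - (i < p)%:R) * w i = p%:R - S.
  by rewrite -wsum -sumrB; apply: eq_bigr => i _; rewrite mulrBl mul1r.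
under eq_bigr do rewrite mulrBr mulrC.
rewrite sumrB; lra.
Qed.

(** The columns of [X0] are eigenvectors for the [p] largest eigenvalues. Conjugation by [Q]
    preserves traces and Frobenius distances, which reduces the claim to the diagonal case with
    [Z = Q X]. *)
Theorem stiefel_trace_gap (A : 'M[R]_n) (gamma : R) : A \is symmetricmx ->
  gamma <= lambda p A - lambda p.+1 A ->
  exists X0 : 'M[R]_(n, p),
    [/\ stiefel X0, A *m (X0 *m X0^T) = (X0 *m X0^T) *m A
      & forall X : 'M[R]_(n, p), stiefel X ->
        \tr (X^T *m A *m X)
          + gamma / 2 * frob_dot (X0 *m X0^T - X *m X^T) (X0 *m X0^T - X *m X^T)
        <= \tr (X0^T *m A *m X0)].
Proof.
move=> symA gap; have [Q [d [QQ AE dE dmono]]] := sorted_spectral symA.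
have QTQ : Q^T *m Q = 1%:M by exact: mulmx1C.
pose J : 'M[R]_(n, p) := pid_mx p.
have JJ : J^T *m J = 1%:M.
  by rewrite /J tr_pid_mx mul_pid_mx minnn (minn_idPr (ltnW p_lt_n)) pid_mx_1.
have JJT : J *m J^T = E by rewrite /J tr_pid_mx mul_pid_mx !minnn.
exists (Q^T *m J).
have XX : Q^T *m J *m (Q^T *m J)^T = Q^T *m E *m Q.
  by rewrite trmx_mul trmxK !mulmxA -(mulmxA Q^T) JJT.
have sX0 : stiefel (Q^T *m J).
  by rewrite /stiefel /= trmx_mul trmxK mulmxA -(mulmxA J^T) QQ mulmx1 JJ.
rewrite !XX; split => //.
  rewrite AE !mulmxA -(mulmxA _ Q Q^T) QQ mulmx1 -(mulmxA _ Q Q^T) QQ mulmx1.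
  congr (_ *m _); rewrite -!mulmxA; congr (_ *m _).
  apply/matrixP => i j; rewrite mul_mx_diag mul_diag_mx !mxE.
  by case: eqP => [/val_inj ->|]; rewrite ?mul0r ?mulr0 // mulrC.
move=> X sX; pose Z := Q *m X.
have sZ : stiefel Z.
  by rewrite /stiefel /= trmx_mul mulmxA -(mulmxA _ Q^T) QTQ mulmx1 sX.
have n0 : (p.-1 < n)%N by rewrite prednK // ltnW.
have := diag_trace_gap (i0 := Ordinal n0) (i1 := Ordinal p_lt_n) dmono erefl erefl sZ.
rewrite !dE /= prednK //.
have -> : \tr (Z^T *m diag_mx d *m Z) = \tr (X^T *m A *m X).
  by rewrite AE trmx_mul !mulmxA.
have -> : frob_dot E (diag_mx d) = \tr ((Q^T *m J)^T *m A *m (Q^T *m J)).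
  rewrite -JJT frob_dotC frob_dot_gram tr_diag_mx AE trmx_mul trmxK !mulmxA.
  by rewrite -(mulmxA _ Q Q^T) QQ mulmx1 -(mulmxA _ Q Q^T) QQ mulmx1.
have -> : frob_dot (E - Z *m Z^T) (E - Z *m Z^T) =
    frob_dot (Q^T *m E *m Q - X *m X^T) (Q^T *m E *m Q - X *m X^T).
  have -> : Q^T *m E *m Q - X *m X^T = Q^T *m (E - Z *m Z^T) *m Q.
    rewrite mulmxBr mulmxBl /Z trmx_mul !mulmxA QTQ mul1mx.
    by rewrite -(mulmxA _ Q^T) QTQ mulmx1.
  move: (E - _) => M; rewrite /frob_dot !trmx_mul trmxK !mulmxA.
  by rewrite -(mulmxA _ Q Q^T) QQ mulmx1 [RHS]mxtrace_mulC !mulmxA QQ mul1mx.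
apply: le_trans; rewrite lerD2l ler_wpM2r ?frob_dot_ge0 //; lra.
Qed.

End EigenvalueGap.

(** * Orthogonal projection onto the tangent space of the affine constraints *)

Section TangentProjection.
Variables (R : realType) (n m : nat).
Variable W : 'I_m -> 'M[R]_n.
Hypothesis symW : forall j, W j \is symmetricmx.

Lemma frob_dot_span (mu : 'I_m -> R) (Z : 'M[R]_n) :
  frob_dot (\sum_j mu j *: W j) Z = \sum_j mu j * frob_dot (W j) Z.
Proof. by rewrite frob_dot_suml; apply: eq_bigr => j _; rewrite frob_dotZl. Qed.

(* Solvability of the normal equations: the kernel of the Gram matrix consists
   of the linear relations between the [W j]. *)
Lemma span_residual (G : 'M[R]_n) : exists mu : 'cV[R]_m, forall j,
  frob_dot (W j) (G - \sum_i mu i 0 *: W i) = 0.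
Proof.
pose K := \matrix_(i, j) frob_dot (W i) (W j).
pose g := \row_j frob_dot (W j) G.
have : (g <= K)%MS.
  (* Membership in the row space is tested against the cokernel. A cokernel column gives a
     combination [V] of the [W j] orthogonal to every [W i], so [V = 0] and the test value [<V, G>]
     vanishes. *)
  rewrite submxE; have := mulmx_coker K; move: (cokermx K) => C KC.
  apply/eqP/rowP => l; rewrite !mxE; pose V := \sum_j C j l *: W j.
  have -> : \sum_j g 0 j * C j l = frob_dot V G.
    by rewrite /V frob_dot_span; apply: eq_bigr => j _; rewrite mxE mulrC.
  suff -> : V = 0 by rewrite frob_dotC frob_dot0r.
  apply: frob_dot_eq0; rewrite {1}/V frob_dot_span big1 // => i _.
  suff -> : frob_dot (W i) V = (K *m C) i l by rewrite KC mxE mulr0.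
  rewrite frob_dotC /V frob_dot_span mxE.
  by apply: eq_bigr => j _; rewrite mxE mulrC frob_dotC.
move=> /submxP[x gE]; exists x^T => j.
rewrite !frob_lin frob_dotC [X in _ - X]frob_dotC frob_dot_span.
have /rowP/(_ j) := gE; rewrite !mxE frob_dotC => ->.
by apply/eqP; rewrite subr_eq0; apply/eqP/eq_bigr => i _; rewrite !mxE.
Qed.

Lemma tangent_residual (G : 'M[R]_n) : G \is symmetricmx ->
  exists mu : 'cV[R]_m, tangent_set W (G - \sum_j mu j 0 *: W j).
Proof.
move=> symG; have [mu muP] := span_residual G; exists mu; split=> [|j].
  by rewrite symB // sym_sum // => i; rewrite symZ.
by rewrite -(muP j) /frob_dot sym_trmx.
Qed.

Lemma tangent_orth_span (mu : 'cV[R]_m) (Z : 'M[R]_n) : tangent_set W Z ->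
  frob_dot (\sum_j mu j 0 *: W j) Z = 0.
Proof.
move=> [_ tZ]; rewrite frob_dot_span big1 // => j _.
by rewrite /frob_dot sym_trmx // tZ mulr0.
Qed.

(** The residual of the normal equations witnesses that the [xget] in [proj_tangent] selects a
    genuine projection. *)
Lemma proj_tangentP (G : 'M[R]_n) : G \is symmetricmx ->
  tangent_set W (proj_tangent W G) /\
  forall Z, tangent_set W Z -> frob_dot (G - proj_tangent W G) Z = 0.
Proof.
move=> symG; apply: (@xgetPex _ 0 [set P | tangent_set W P /\
  forall Z, tangent_set W Z -> frob_dot (G - P) Z = 0]).
have [mu muP] := tangent_residual symG.
exists (G - \sum_j mu j 0 *: W j); split => // Z tZ.
by rewrite opprB addrC subrK tangent_orth_span.
Qed.

(** Source of the multipliers: the residual of [G] is tangent and also orthogonal to all tangent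
    directions, so it is orthogonal to itself. *)
Lemma orth_tangent_span (G : 'M[R]_n) : G \is symmetricmx ->
  (forall Z, tangent_set W Z -> frob_dot G Z = 0) ->
  exists mu : 'cV[R]_m, G = \sum_j mu j 0 *: W j.
Proof.
move=> symG orthG; have [mu muP] := tangent_residual symG; exists mu.
apply/eqP; rewrite -subr_eq0; apply/eqP/frob_dot_eq0.
by rewrite {1}frob_dotDl frob_dotNl tangent_orth_span // subr0 orthG.
Qed.

End TangentProjection.

(** * Quadratic bounds for a function with Lipschitz gradient *)

Section Descent.
Variables (R : realType) (n : nat) (f : 'M[R]_n -> R) (L : R).
Hypotheses (diff_f : continuously_differentiable f) (lip_f : gradient_lipschitz L f).

Lemma gradientP (Y : 'M[R]_n) : Y \is symmetricmx -> is_gradient f Y (gradient f Y).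
Proof. by move=> symY; apply: xgetPex; case: diff_f => ex_grad _; exact: ex_grad. Qed.

Lemma gradient_sym (Y : 'M[R]_n) : Y \is symmetricmx -> gradient f Y \is symmetricmx.
Proof. by move=> /gradientP []. Qed.

Lemma is_derive_line (U H : 'M[R]_n) (t : R) :
  U \is symmetricmx -> H \is symmetricmx ->
  is_derive t 1 (fun s : R => f (U + s *: H))
    (frob_dot (gradient f (U + t *: H)) H).
Proof.
move=> symU symH; set g := frob_dot _ _; set h := fun s => _.
have symUt : U + t *: H \is symmetricmx by rewrite symD ?symZ.
have [_ gradP] := gradientP symUt.
suff cvg_g : s^-1 *: ((h \o shift t) (s *: (1 : R)) - h t) @[s --> 0^'] --> g.
  by split; [apply/cvg_ex; exists g | exact: cvg_lim cvg_g].
apply/cvgrPdist_le => e e0.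
(* Adding 1 keeps the divisor positive when [H = 0]. *)
pose N := frob_norm H + 1.
have N0 : 0 < N by rewrite /N ltr_wpDl ?frob_norm_ge0.
have [d d0 dP] := gradP (e / N) (divr_gt0 e0 N0).
have dN0 : 0 < d / N by exact: divr_gt0.
near=> s.
have s0 : s != 0 by near: s; exact: nbhs_dnbhs_neq.
have sd : `|s| <= d / N.
  near: s; apply: nbhs_dnbhs; near=> s; apply/ltW.
  rewrite -[s]subr0 distrC; near: s; exact: nbhsx_ballx.
have nsH : frob_norm (s *: H) <= `|s| * N.
  by rewrite frob_normZ ler_wpM2l // /N lerDl.
have := dP (s *: H) (symZ _ symH).
have -> : frob_norm (s *: H) <= d.
  by apply: le_trans nsH _; rewrite -ler_pdivlMr.
move=> /(_ isT).
have -> : U + t *: H + s *: H = U + (t + s) *: H by rewrite scalerDl addrA.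
rewrite frob_dotZr => le_e.
rewrite /h /= /shift /= -/h.
rewrite distrC.
have -> : s^-1 *: (f (U + (s *: 1 + t) *: H) - f (U + t *: H)) - g
   = s^-1 * (f (U + (t + s) *: H) - f (U + t *: H) - s * g).
  by rewrite [s *: 1]mulr1 (addrC s) mulrBr mulKf.
rewrite normrM normfV ler_pdivrMl ?normr_gt0 //.
apply: le_trans le_e _; apply: le_trans (ler_wpM2l _ nsH) _.
  by rewrite divr_ge0 // ltW.
by rewrite mulrCA divfK // gt_eqF.
Unshelve. all: by end_near. Qed.

(** The mean value theorem is applied to [phi] minus [dphi 0 * t + K / 2 * t^2], whose derivative is
    nonpositive for [t >= 0]; no integral is involved. *)
Lemma mean_value_bound (phi dphi : R -> R) (K : R) :
  (forall t : R, is_derive t 1 phi (dphi t)) ->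
  (forall t, 0 <= t -> dphi t <= dphi 0 + K * t) ->
  phi 1 <= phi 0 + dphi 0 + K / 2.
Proof.
move=> der le_dphi.
pose psi := phi - (dphi 0 \*: @id R + K / 2 \*: @id R ^+ 2).
have der_psi (t : R) : is_derive t 1 psi (dphi t - (dphi 0 + K * t)).
  have dphit := der t; apply: is_derive_eq => /=.
  by rewrite expr1 /GRing.scale /=; field.
have cont : {within `[0, 1], continuous psi}.
  by apply: derivable_within_continuous => s _; have := der_psi s; case.
have [c] := MVT ltr01 (fun s _ => der_psi s) cont.
rewrite in_itv /= => /andP[c0 _].
rewrite /psi !fctE /= subr0 mulr1 => E.
have := le_dphi c (ltW c0); move: E.
rewrite /GRing.scale /= !expr2 !mulr0 !mulr1; lra.
Qed.

Lemma lipschitz_dot_le (U H : 'M[R]_n) (t : R) : 0 <= t ->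
  U \is symmetricmx -> H \is symmetricmx ->
  `|frob_dot (gradient f (U + t *: H)) H - frob_dot (gradient f U) H|
    <= L * frob_dot H H * t.
Proof.
move=> t0 symU symH; rewrite -frob_dotNl -frob_dotDl.
apply: le_trans (frob_dot_norm_le _ _) _.
have := lip_f (symD symU (symZ t symH)) symU.
rewrite [U + _]addrC addrK frob_normZ ger0_norm // => le_grad.
rewrite -sqr_frob_norm; have := frob_norm_ge0 H; nra.
Qed.

Lemma descent_upper (U H : 'M[R]_n) : U \is symmetricmx -> H \is symmetricmx ->
  f (U + H) <= f U + frob_dot (gradient f U) H + L / 2 * frob_dot H H.
Proof.
move=> symU symH.
have := @mean_value_bound _ _ (L * frob_dot H H)
  (fun t => is_derive_line t symU symH).
rewrite scale0r addr0 scale1r mulrAC; apply=> t t0.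
by have := lipschitz_dot_le t0 symU symH; rewrite ler_norml; lra.
Qed.

(** The same argument as for [descent_upper], run on [- f]. *)
Lemma descent_lower (U H : 'M[R]_n) : U \is symmetricmx -> H \is symmetricmx ->
  f U + frob_dot (gradient f U) H - L / 2 * frob_dot H H <= f (U + H).
Proof.
move=> symU symH.
have := @mean_value_bound _ _ (L * frob_dot H H)
  (fun t => is_deriveN (is_derive_line t symU symH)).
rewrite !fctE scale0r addr0 scale1r mulrAC => le_f.
suff : - f (U + H) <= - f U - frob_dot (gradient f U) H + L / 2 * frob_dot H H by lra.
apply: le_f => t t0.
by have := lipschitz_dot_le t0 symU symH; rewrite ler_norml; lra.
Qed.

End Descent.

(** A maximizer is determined only up to a rotation of its columns, but its projector is unique: the
    growth inequality at [X] forces [X X^T = X0 X0^T], and the properties of [X0] carry over. *)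
Lemma stiefel_maximizer_gap (R : realType) (n p : nat) (A : 'M[R]_n)
    (gamma : R) (X : 'M[R]_(n, p)) :
  (0 < p)%N -> (p < n)%N -> A \is symmetricmx -> 0 < gamma ->
  gamma <= lambda p A - lambda p.+1 A -> stiefel X ->
  (forall X' : 'M[R]_(n, p), stiefel X' ->
    \tr (X'^T *m A *m X') <= \tr (X^T *m A *m X)) ->
  A *m (X *m X^T) = (X *m X^T) *m A /\
  forall X' : 'M[R]_(n, p), stiefel X' ->
    \tr (X'^T *m A *m X')
      + gamma / 2 * frob_dot (X *m X^T - X' *m X'^T) (X *m X^T - X' *m X'^T)
    <= \tr (X^T *m A *m X).
Proof.
move=> p0 pn symA gamma0 gap sX maxX.
have [X0 [sX0 comm le0]] := stiefel_trace_gap p0 pn symA gap.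
suff PE : X0 *m X0^T = X *m X^T.
  split=> [|X' sX']; first by rewrite -PE.
  by rewrite -PE; apply: le_trans (le0 _ sX') (maxX _ sX0).
apply/eqP; rewrite -subr_eq0; apply/eqP/frob_dot_eq0.
have := frob_dot_ge0 (X0 *m X0^T - X *m X^T); have := maxX _ sX0.
have := le0 _ sX; move: (frob_dot _ _) => x; nra.
Qed.

(** [v] is nonincreasing and bounded below, hence convergent, and [e * u k] is at most its
    decrement. *)
Lemma sufficient_decrease_cvg0 (R : realType) (u v : nat -> R) (C e : R) :
  0 < e -> (forall k, 0 <= u k) -> (forall k, v k.+1 + e * u k <= v k) ->
  (forall k, C <= v k) -> u @ \oo --> 0.
Proof.
move=> e0 u0 dec vC.
have cvg_v : cvg (v @ \oo).
  apply: nonincreasing_is_cvgn.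
    apply/nonincreasing_seqP => k; apply: le_trans (dec k).
    by rewrite lerDl mulr_ge0 // ltW.
  by exists C => _ [k _ <-].
have cvg_dv : e^-1 * (v k - v k.+1) @[k --> \oo] --> 0.
  rewrite -[X in _ --> X](mulr0 e^-1) -(subrr (lim (v @ \oo))).
  by apply: cvgMr; apply: cvgB => //; rewrite (cvg_shiftS v).
apply: (squeeze_cvgr _ (cvg_cst 0) cvg_dv); apply: nearW => k.
by rewrite u0 ler_pdivlMl //; have := dec k; lra.
Qed.

(** * Descent and coercivity of the Lyapunov function along the iterates *)

Section Lyapunov.
Variables (R : realType) (n p m : nat).
Hypotheses (p_gt0 : (1 <= p)%N) (p_lt_n : (p < n)%N).
Variables (f : 'M[R]_n -> R) (W : 'I_m -> 'M[R]_n) (b : 'I_m -> R).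
Hypothesis symW : forall j, W j \is symmetricmx.
Variables (beta tau delta : R) (etas : nat -> R).
Variables (X : nat -> 'M[R]_(n, p)) (Y Lam : nat -> 'M[R]_n).
Hypothesis alg : DASSP f W b beta tau delta etas X Y Lam.
Hypothesis delta_in : 0 < delta < 1.
Variable c : R.
Hypothesis c_gt : 2 * (1 - delta) * (2 - delta) / delta < c.
Variable L : R.
Hypothesis L_gt0 : 0 < L.
Hypothesis diff_f : continuously_differentiable f.
Hypothesis lip_f : gradient_lipschitz L f.
Variable gamma : R.
Hypothesis gamma_gt0 : 0 < gamma.
Hypothesis gap : forall k, gamma <= lambda p (A_mx beta delta Y Lam k)
                              - lambda p.+1 (A_mx beta delta Y Lam k).
Hypothesis beta_gt : 2 * (L + 1) < beta.
Variable eta : R.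
Hypothesis eta_const : forall k, etas k = eta.
Hypothesis eta_in : 0 < eta < 2 / (beta + L).
Hypothesis tau_in : 0 < tau < delta / (2 * c)
  * Num.min (1 / beta * (1 / eta - (beta + L) / 2)) (gamma / n%:R).

Notation P k := (X k *m (X k)^T).
Notation sq A := (frob_dot A A).
Notation G k := (gradient f (Y k) + (1 - delta) *: Lam k
                 + beta *: (Y k - P k.+1)).

(** The three facts go through one induction: the Y-step stays in the affine set because the
    projection of [G k] is tangent, which requires [G k] to be symmetric. *)
Lemma iterates_sym k :
  [/\ affine_set W b (Y k), Lam k \is symmetricmx & G k \is symmetricmx].
Proof.
have symG j : Y j \is symmetricmx -> Lam j \is symmetricmx ->
    G j \is symmetricmx.
  move=> symY symL; rewrite !symD ?symZ ?gradient_sym //.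
  by rewrite symB // gram_sym.
elim: k => [|k [[symY affY] symL symGk]].
  have affY := dassp_Y0 alg; have symL := dassp_Lam0 alg.
  by split => //; apply: symG => //; case: affY.
have [[symP tP] _] := proj_tangentP symW symGk.
have affY' : affine_set W b (Y k.+1).
  rewrite (dassp_Y alg); split=> [|j]; first by rewrite symB ?symZ.
  by rewrite mulmxBr mxtraceD raddfN /= -scalemxAr mxtraceZ tP mulr0 subr0.
have symL' : Lam k.+1 \is symmetricmx.
  by rewrite (dassp_Lam alg) symD ?symZ // symB ?gram_sym //; case: affY'.
by split=> //; apply: symG => //; case: affY'.
Qed.

Lemma Y_sym k : Y k \is symmetricmx.
Proof. by have [[]] := iterates_sym k. Qed.

Lemma Lam_sym k : Lam k \is symmetricmx.
Proof. by have [] := iterates_sym k. Qed.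

Lemma A_sym k : A_mx beta delta Y Lam k \is symmetricmx.
Proof. by rewrite /A_mx symD ?symZ ?Y_sym ?Lam_sym. Qed.

Lemma X_stiefel k : stiefel (X k.+1).
Proof. by have [] := dassp_X alg k. Qed.

Lemma X_step_gap k :
  A_mx beta delta Y Lam k *m P k.+1 = P k.+1 *m A_mx beta delta Y Lam k /\
  forall X' : 'M[R]_(n, p), stiefel X' ->
    frob_dot (A_mx beta delta Y Lam k) (X' *m X'^T)
      + gamma / 2 * sq (P k.+1 - X' *m X'^T)
    <= frob_dot (A_mx beta delta Y Lam k) (P k.+1).
Proof.
have [sX minX] := dassp_X alg k.
have maxX (X' : 'M[R]_(n, p)) (sX' : stiefel X') := minX X' sX'.
have [|comm gapX] := stiefel_maximizer_gap p_gt0 p_lt_n (A_sym k) gamma_gt0 (gap k) sX.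
  by move=> X' sX'; rewrite -lerN2 maxX.
split=> // X' sX'; rewrite !frob_dot_gram !(sym_trmx (A_sym k)); exact: gapX.
Qed.

Let beta_gt0 : 0 < beta. Proof. exact: dassp_beta alg. Qed.
Let tau_gt0 : 0 < tau. Proof. by have /andP[] := tau_in. Qed.
Let eta_gt0 : 0 < eta. Proof. by have /andP[] := eta_in. Qed.
Let delta_gt0 : 0 < delta. Proof. by have /andP[] := delta_in. Qed.
Let delta_lt1 : delta < 1. Proof. by have /andP[] := delta_in. Qed.
(** Up to the factor [1 / t], the coefficient of [|Lam_(k+1) - Lam_k|^2] produced by the multiplier
    step, see [Lam_step]. *)
Let a := (1 - delta) * (2 - delta) / 2.

Let a_lt : 4 * a < c * delta.
Proof. by move: c_gt; rewrite ltr_pdivrMr // /a; lra. Qed.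

Let a_gt0 : 0 < a.
Proof.
by rewrite /a divr_gt0 ?mulr_gt0 //; move: delta_lt1; lra.
Qed.

Let c_gt0 : 0 < c.
Proof.
rewrite -(pmulr_lgt0 _ delta_gt0); apply: lt_trans a_lt.
by rewrite mulr_gt0.
Qed.

(** The left side is [c / t] times the factor [2 t^2 / delta] of [Lam_diff_sq]: the price of the
    multiplier step per unit of [|Y_(k+1) - Y_k|^2]. In [P_margin] it is the price per unit of
    [|P_(k+1) - P_k|^2]. *)
Let Y_margin : 2 * c * tau * beta / delta < eta^-1 - (beta + L) / 2.
Proof.
have /andP[_] := tau_in; set M := Num.min _ _ => tau_lt.
have M_le : M <= 1 / beta * (1 / eta - (beta + L) / 2) by rewrite ge_min lexx.
have d2c : 0 < delta / (2 * c) by rewrite divr_gt0 // mulr_gt0.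
have := lt_le_trans tau_lt (ler_wpM2l (ltW d2c) M_le).
have -> : delta / (2 * c) * (1 / beta * (1 / eta - (beta + L) / 2)) =
    (eta^-1 - (beta + L) / 2) / (2 * c * beta / delta).
  by field; rewrite !gt_eqF.
by rewrite ltr_pdivlMr ?divr_gt0 ?mulr_gt0 // !mulrA; lra.
Qed.

Let P_margin : 2 * c * tau * beta / delta < beta * gamma / 2.
Proof.
have /andP[_] := tau_in; set M := Num.min _ _ => tau_lt.
(* Here [n >= 2], because [1 <= p < n]. *)
have M_le : M <= gamma / 2.
  apply: (@le_trans _ _ (gamma / n%:R)); first by rewrite ge_min lexx orbT.
  rewrite ler_pM2l // lef_pV2 ?posrE ?ltr0n ?(leq_ltn_trans _ p_lt_n) //.
  by rewrite ler_nat (leq_ltn_trans p_gt0).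
have d2c : 0 < delta / (2 * c) by rewrite divr_gt0 // mulr_gt0.
have := lt_le_trans tau_lt (ler_wpM2l (ltW d2c) M_le).
have -> : delta / (2 * c) * (gamma / 2) =
    (beta * gamma / 2) / (2 * c * beta / delta).
  by field; rewrite !gt_eqF.
by rewrite ltr_pdivlMr ?divr_gt0 ?mulr_gt0 // !mulrA; lra.
Qed.

Definition aug_lagrangian (Q Z M : 'M[R]_n) : R :=
  f Z + (1 - delta) * frob_dot M (Z - Q) + beta / 2 * sq (Z - Q).

(** All projectors have squared norm [p], so as a function of the projector [Q] the Lagrangian is a
    constant minus [beta <A, Q>]; the gain is [beta] times that of [X_step_gap]. *)
Lemma X_step_decrease k :
  aug_lagrangian (P k.+2) (Y k.+1) (Lam k.+1) + beta * gamma / 2 * sq (P k.+2 - P k.+1)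
  <= aug_lagrangian (P k.+1) (Y k.+1) (Lam k.+1).
Proof.
have [_ /(_ _ (X_stiefel k))] := X_step_gap k.+1.
have := stiefel_frob_dot (X_stiefel k); have := stiefel_frob_dot (X_stiefel k.+1).
rewrite /A_mx /aug_lagrangian; set s := sq (P k.+2 - _).
have [r -> ->] : exists2 r, (1 - delta) / beta = r & 1 - delta = beta * r.
  by exists ((1 - delta) / beta) => //; rewrite mulrC divfK ?gt_eqF.
rewrite !frob_lin !(frob_dotC (P _) (Y _)).
by move=> -> -> /(ler_wpM2l (ltW beta_gt0)); lra.
Qed.

(** [G k] is the gradient of the Lagrangian in [Y]. The step [y] is [- eta] times its projection, so
    [<G k, y> = - |y|^2 / eta]; the second-order cost is [L / 2] from [f] and exactly [beta / 2]
    from the penalty. *)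
Lemma Y_step_decrease k :
  aug_lagrangian (P k.+1) (Y k.+1) (Lam k)
    + (eta^-1 - (beta + L) / 2) * sq (Y k.+1 - Y k)
  <= aug_lagrangian (P k.+1) (Y k) (Lam k).
Proof.
have [_ _ symG] := iterates_sym k.
have [[symPr tPr] orthPr] := proj_tangentP symW symG.
pose y := Y k.+1 - Y k; rewrite -/y.
have yE : y = - eta *: proj_tangent W (G k).
  by rewrite /y (dassp_Y alg) eta_const addrC addKr scaleNr.
have YE : Y k.+1 = Y k + y by rewrite addrC subrK.
have symy : y \is symmetricmx by rewrite yE symZ.
have Gy : frob_dot (G k) y = - (eta^-1 * sq y).
  have := orthPr _ (conj symPr tPr); rewrite frob_dotDl frob_dotNl => /eqP.
  rewrite subr_eq0 => /eqP GP.
  by rewrite yE frob_dotZr GP frob_dotZl frob_dotZr; field; rewrite gt_eqF.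
have := descent_upper diff_f lip_f (Y_sym k) symy; rewrite -YE.
move: Gy; rewrite /aug_lagrangian YE; clearbody y.
rewrite !frob_lin.
rewrite !(frob_dotC y (Y k)) !(frob_dotC (P k.+1)) => Gy.
lra.
Qed.

Let t := tau * beta.
Let t_gt0 : 0 < t. Proof. exact: mulr_gt0. Qed.

(** The [|Lam|^2] term telescopes the exact change found in [Lam_step]. The weight [c - a] is chosen
    so that, with the [a / t] of that step, the new multiplier difference carries [c / t]. *)
Definition lyapunov k : R :=
  aug_lagrangian (P k.+1) (Y k.+1) (Lam k.+1)
  - (1 - delta) * delta / (2 * t) * sq (Lam k.+1)
  + (c - a) / t * sq (Lam k.+1 - Lam k).

(** The multiplier update solved for the residual, with [Lam k] traded for the difference of
    successive multipliers. *)
Lemma residualE k :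
  Y k.+1 - P k.+1 = t^-1 *: (delta *: Lam k.+1 + (1 - delta) *: (Lam k.+1 - Lam k)).
Proof.
have -> : delta *: Lam k.+1 + (1 - delta) *: (Lam k.+1 - Lam k) =
    Lam k.+1 - (1 - delta) *: Lam k.
  by rewrite scalerBr addrA -scalerDl [delta + _]addrC subrK scale1r.
rewrite {1}(dassp_Lam alg) [X in _ = _ *: X]addrC addKr.
by rewrite scalerA mulVf ?scale1r // gt_eqF.
Qed.

(** The change is [(1 - delta) <Lam_(k+2) - Lam_(k+1), Y - P>]. After [residualE], polarization
    splits it into a difference of [|Lam|^2] terms and a square with coefficient [(1 - delta) (delta
    / 2 + 1 - delta) / t = a / t]. *)
Lemma Lam_step k :
  aug_lagrangian (P k.+2) (Y k.+2) (Lam k.+2)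
    - (1 - delta) * delta / (2 * t) * sq (Lam k.+2)
  = aug_lagrangian (P k.+2) (Y k.+2) (Lam k.+1)
    - (1 - delta) * delta / (2 * t) * sq (Lam k.+1)
    + a / t * sq (Lam k.+2 - Lam k.+1).
Proof.
have := residualE k.+1; rewrite /aug_lagrangian; set r := Y k.+2 - _ => ->.
rewrite !frob_lin (frob_dotC (Lam k.+2) (Lam k.+1)) /a.
by field; rewrite gt_eqF.
Qed.

(** Subtracting two updates gives [(1 - delta) d + t (y - q)]. Convexity of the square with weights
    [1 - delta] and [delta], then [|y - q|^2 <= 2 (|y|^2 + |q|^2)], yield the bound; damping
    supplies the contraction factor. *)
Lemma Lam_diff_sq k :
  sq (Lam k.+2 - Lam k.+1) <= (1 - delta) * sq (Lam k.+1 - Lam k)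
    + 2 * t ^+ 2 / delta * (sq (Y k.+2 - Y k.+1) + sq (P k.+2 - P k.+1)).
Proof.
set y := Y k.+2 - _; set q := P k.+2 - _; set d := Lam k.+1 - _.
have -> : Lam k.+2 - Lam k.+1 = (1 - delta) *: d + t *: (y - q).
  rewrite (dassp_Lam alg k.+1) [in - Lam k.+1](dassp_Lam alg k) opprD addrACA.
  rewrite -!scalerBr; congr (_ + _ *: _).
  by rewrite /y /q opprB addrACA [RHS]addrC addrACA opprB; apply/matrixP => i j;
     rewrite !mxE; ring.
have d1 : 0 < 1 - delta by rewrite subr_gt0.
have := mulr_ge0 (ltW d1) (frob_dot_ge0 (delta *: d - t *: (y - q))).
have := mulr_ge0 (sqr_ge0 t) (frob_dot_ge0 (y + q)).
clearbody y q d => h1 h2; rewrite -(ler_pM2l delta_gt0) [leRHS]mulrDr.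
rewrite [delta * (2 * _ / _ * _)]mulrA [delta * (2 * _ / _)]mulrC divfK ?gt_eqF //.
move: h1 h2; rewrite !frob_lin (frob_dotC y d) (frob_dotC q d) (frob_dotC q y); lra.
Qed.

Lemma lyapunov_decrease : exists2 e, 0 < e & forall k,
  lyapunov k.+1 + e * (sq (Y k.+2 - Y k.+1) + sq (Lam k.+1 - Lam k))
  <= lyapunov k.
Proof.
(* [ey] and [el] are what remains of the Y-step gain and of the old multiplier difference once
   [c / t] times [Lam_diff_sq] is paid; the X-step gain covers the projector part by [P_margin]. *)
pose ey := eta^-1 - (beta + L) / 2 - 2 * c * tau * beta / delta.
pose el := (c * delta - a) / t.
have ey0 : 0 < ey by rewrite subr_gt0.
have el0 : 0 < el by rewrite divr_gt0 //; move: a_lt a_gt0; lra.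
exists (Num.min ey el) => [|k]; first by rewrite lt_min ey0.
have e_ey : Num.min ey el <= ey by rewrite ge_min lexx.
have e_el : Num.min ey el <= el by rewrite ge_min lexx orbT.
have := X_step_decrease k; have := Y_step_decrease k.+1.
rewrite /lyapunov Lam_step.
have ct0 : 0 < c / t by exact: divr_gt0.
have := ler_wpM2l (ltW ct0) (Lam_diff_sq k).
have y0 := frob_dot_ge0 (Y k.+2 - Y k.+1).
have d0 := frob_dot_ge0 (Lam k.+1 - Lam k).
have q0 := frob_dot_ge0 (P k.+2 - P k.+1).
have := ler_wpM2r y0 e_ey; have := ler_wpM2r d0 e_el.
have := ler_wpM2r q0 (ltW P_margin).
have -> : c / t * ((1 - delta) * sq (Lam k.+1 - Lam k) + 2 * t ^+ 2 / delta
    * (sq (Y k.+2 - Y k.+1) + sq (P k.+2 - P k.+1))) =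
    ((c - a) / t - el) * sq (Lam k.+1 - Lam k) + 2 * c * tau * beta / delta
    * (sq (Y k.+2 - Y k.+1) + sq (P k.+2 - P k.+1)).
  by rewrite /el /t; field; rewrite !gt_eqF.
rewrite /ey; lra.
Qed.

(** Half of the net coefficient [(1 - delta) delta / (2 t)] of [|Lam|^2]; the other half absorbs the
    cross term. *)
Let residual_coef := (1 - delta) * delta / (4 * t).

(* By [residualE] the term [<Lam, Y - P>] equals [delta / t |Lam|^2] up to a
   cross term, which outweighs the negative multiple of [|Lam|^2] in [lyapunov]. *)
Lemma lyapunov_ge_residual k :
  f (Y k.+1) + beta / 2 * sq (Y k.+1 - P k.+1) + residual_coef * sq (Lam k.+1)
  <= lyapunov k.
Proof.
rewrite /lyapunov /aug_lagrangian [in frob_dot (Lam k.+1) (_ - _)]residualE.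
set l := Lam k.+1; set d := l - Lam k; set r2 := sq (_ - P _).
have d1 : 0 < 1 - delta by rewrite subr_gt0.
(* [(1 - delta)^3 / delta] is the amount of [|d|^2] consumed when the square of
   [l + 2 (1 - delta) / delta d] is completed. *)
have ca : 0 < c - a - (1 - delta) ^+ 3 / delta.
  rewrite subr_gt0 ltr_pdivrMr //.
  have : 4 * a - a * delta < (c - a) * delta by move: a_lt; lra.
  apply: le_lt_trans; rewrite /a.
  suff : 0 <= (1 - delta) * ((2 - delta) * (4 - delta) / 2 - (1 - delta) ^+ 2) by lra.
  by apply: mulr_ge0; [exact: ltW | move: d1 delta_gt0; nra].
have := mulr_ge0 (ltW ca) (frob_dot_ge0 d).
have := mulr_ge0 (divr_ge0 (mulr_ge0 (ltW d1) (ltW delta_gt0)) (ler0n R 4))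
  (frob_dot_ge0 (l + (2 * (1 - delta) / delta) *: d)).
clearbody d; rewrite !frob_lin (frob_dotC d l) => h1 h2.
have := mulr_ge0 (ltW (etrans (invr_gt0 t) t_gt0)) (addr_ge0 h1 h2).
set u := (X in 0 <= X) => u0; rewrite /residual_coef.
suff : (f (Y k.+1) + (1 - delta) * (t^-1 * (delta * sq l + (1 - delta) * frob_dot l d))
   + beta / 2 * r2 - (1 - delta) * delta / (2 * t) * sq l + (c - a) / t * sq d)
   - (f (Y k.+1) + beta / 2 * r2 + (1 - delta) * delta / (4 * t) * sq l) = u by move=> uE; rewrite -subr_ge0 uE.
by rewrite /u; field; rewrite !gt_eqF.
Qed.

(** Two uses of [descent_lower]: from 0 to the projector, which has norm [sqrt p], and from the
    projector to [Y]. The constant [g] bounds the gradient at the projector. *)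
Lemma f_lower_bound : exists C g, 0 <= g /\ forall k,
  C - g * frob_norm (Y k.+1 - P k.+1) - L / 2 * sq (Y k.+1 - P k.+1) <= f (Y k.+1).
Proof.
have s0 := sym0 R n; pose g0 := frob_norm (gradient f 0).
have normP k : frob_norm (P k.+1) = Num.sqrt p%:R.
  by rewrite /frob_norm stiefel_frob_dot //; exact: X_stiefel.
exists (f 0 - g0 * Num.sqrt p%:R - L / 2 * p%:R), (g0 + L * Num.sqrt p%:R).
split=> [|k]; first by rewrite addr_ge0 ?mulr_ge0 ?sqrtr_ge0 // ltW.
have symP : P k.+1 \is symmetricmx by exact: gram_sym.
have symR := symB (Y_sym k.+1) symP.
have := descent_lower diff_f lip_f symP symR.
have := descent_lower diff_f lip_f s0 symP.
have -> : P k.+1 + (Y k.+1 - P k.+1) = Y k.+1 by rewrite addrC subrK.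
rewrite add0r (stiefel_frob_dot (X_stiefel k)).
have := frob_dot_norm_le (gradient f 0) (P k.+1).
have := frob_dot_norm_le (gradient f (P k.+1)) (Y k.+1 - P k.+1).
have le_grad : frob_norm (gradient f (P k.+1)) <= g0 + L * Num.sqrt p%:R.
  rewrite -(normP k) -[gradient f (P _)](subrK (gradient f 0)).
  rewrite addrC; apply: le_trans (frob_norm_triangle _ _) _.
  by rewrite lerD2l; have := lip_f symP s0; rewrite subr0.
have := ler_wpM2r (frob_norm_ge0 (Y k.+1 - P k.+1)) le_grad.
rewrite normP -/g0 !ler_norml.
move=> h1 /andP[h2 _] /andP[h3 _]; lra.
Qed.

Lemma lyapunov_coercive : exists C e, 0 < e /\ forall k,
  C + e * (sq (Y k.+1 - P k.+1) + sq (Lam k.+1)) <= lyapunov k.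
Proof.
have [C [g [g0 fP]]] := f_lower_bound.
have bL : 0 < (beta - L) / 4 by move: beta_gt L_gt0; lra.
have rc0 : 0 < residual_coef by rewrite divr_gt0 ?mulr_gt0 // subr_gt0.
(* The net quadratic coefficient is [(beta - L) / 2 = 2 v]: one [v] absorbs the linear term at cost
   [g^2 / (4 v)], the other remains. *)
pose v := (beta - L) / 4.
exists (C - g ^+ 2 / (4 * v)), (Num.min v residual_coef).
split=> [|k]; first by rewrite lt_min bL.
apply: le_trans (lyapunov_ge_residual k).
have e1 : Num.min v residual_coef <= v by rewrite ge_min lexx.
have e2 : Num.min v residual_coef <= residual_coef by rewrite ge_min lexx orbT.
have := ler_wpM2r (frob_dot_ge0 (Y k.+1 - P k.+1)) e1.
have := ler_wpM2r (frob_dot_ge0 (Lam k.+1)) e2.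
have := fP k; rewrite -!sqr_frob_norm.
move: (frob_norm _) => r; set l := frob_norm _ ^+ 2.
have : 0 <= v * (r - g / (2 * v)) ^+ 2 by rewrite mulr_ge0 ?sqr_ge0 // ltW.
have -> : v * (r - g / (2 * v)) ^+ 2 = v * r ^+ 2 - g * r + g ^+ 2 / (4 * v).
  by field; rewrite gt_eqF.
have -> : beta = 4 * v + L by rewrite /v; lra.
clearbody v; lra.
Qed.

Lemma lyapunov_le0 k : lyapunov k <= lyapunov 0.
Proof.
have [e e0 dec] := lyapunov_decrease; elim: k => // k IH.
apply: le_trans IH; apply: le_trans (dec k); rewrite lerDl mulr_ge0 ?addr_ge0 ?frob_dot_ge0 //.
exact: ltW.
Qed.

Lemma iterates_bounded : exists B, forall k,
  [/\ forall i j, `|X k.+1 i j| <= B, forall i j, `|Y k.+1 i j| <= B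
    & forall i j, `|Lam k.+1 i j| <= B].
Proof.
have [C [e [e0 coer]]] := lyapunov_coercive.
pose K := (lyapunov 0 - C) / e.
have sumK k : sq (Y k.+1 - P k.+1) + sq (Lam k.+1) <= K.
  by rewrite ler_pdivlMr // mulrC; have := le_trans (coer k) (lyapunov_le0 k); lra.
have norm_le (A : 'M[R]_n) : sq A <= K -> frob_norm A <= 1 + K.
  by rewrite -sqr_frob_norm; move: (frob_norm A) => r; nra.
have K0 : 0 <= K.
  by apply: le_trans (sumK 0%N); rewrite addr_ge0 ?frob_dot_ge0.
have s0 := sqrtr_ge0 (p%:R : R).
exists (Num.sqrt p%:R + (1 + K)) => k; split=> i j;
  apply: le_trans (entry_le_frob_norm _ _ _) _.
- rewrite /frob_norm /frob_dot X_stiefel mxtrace1; lra.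
- rewrite -[Y k.+1](subrK (P k.+1)) addrC.
  apply: le_trans (frob_norm_triangle _ _) _; apply: lerD.
    by rewrite /frob_norm (stiefel_frob_dot (X_stiefel k)).
  by apply: norm_le; apply: le_trans (sumK k); rewrite lerDl frob_dot_ge0.
- suff : frob_norm (Lam k.+1) <= 1 + K by lra.
  by apply: norm_le; apply: le_trans (sumK k); rewrite lerDr frob_dot_ge0.
Qed.

Lemma successive_differences_cvg0 :
  (frob_norm (Y k.+2 - Y k.+1) @[k --> \oo] --> 0) /\
  (frob_norm (Lam k.+1 - Lam k) @[k --> \oo] --> 0).
Proof.
have [e e0 dec] := lyapunov_decrease.
have [C [e' [e'0 coer]]] := lyapunov_coercive.
have bound k : C <= lyapunov k.
  apply: le_trans (coer k); rewrite lerDl mulr_ge0 ?addr_ge0 ?frob_dot_ge0 //.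
  exact: ltW.
have sqrt_cvg0 (A : nat -> 'M[R]_n) :
    (forall k, lyapunov k.+1 + e * sq (A k) <= lyapunov k) ->
    frob_norm (A k) @[k --> \oo] --> 0.
  move=> decA; rewrite -[X in _ --> X](sqrtr0 R).
  apply: continuous_cvg; first exact: sqrt_continuous.
  apply: sufficient_decrease_cvg0 e0 _ decA bound => k; exact: frob_dot_ge0.
split; apply: sqrt_cvg0 => k; apply: le_trans (dec k);
  by rewrite lerD2l ler_pM2l // ?lerDl ?lerDr frob_dot_ge0.
Qed.

End Lyapunov.

(** * Entrywise limits of matrices along a filter *)

Section EntrywiseConvergence.
Variable R : realType.

(** The filter is arbitrary so that the one attached to an accumulation point can replace a
    convergent subsequence. *)
Definition entrywise_cvg m n (F : set_system nat) (A_ : nat -> 'M[R]_(m, n))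
    (A : 'M[R]_(m, n)) : Prop :=
  forall i j, A_ k i j @[k --> F] --> A i j.

Variable F : set_system nat.
Hypothesis FF : ProperFilter F.

Lemma cvg_sumr (I : finType) (u : I -> nat -> R) (l : I -> R) :
  (forall i, u i k @[k --> F] --> l i) ->
  \sum_i u i k @[k --> F] --> \sum_i l i.
Proof. by move=> ul; apply: cvg_big => //; exact: add_continuous. Qed.

Lemma entrywise_cvg_cst m n (A : 'M[R]_(m, n)) : entrywise_cvg F (fun=> A) A.
Proof. by move=> i j; exact: cvg_cst. Qed.

Lemma entrywise_cvgD m n (A_ B_ : nat -> 'M[R]_(m, n)) A B :
  entrywise_cvg F A_ A -> entrywise_cvg F B_ B ->
  entrywise_cvg F (fun k => A_ k + B_ k) (A + B).
Proof.
move=> cA cB i j; under eq_fun do rewrite mxE.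
by rewrite mxE; apply: cvgD.
Qed.

Lemma entrywise_cvgZ m n (A_ : nat -> 'M[R]_(m, n)) A a :
  entrywise_cvg F A_ A -> entrywise_cvg F (fun k => a *: A_ k) (a *: A).
Proof.
move=> cA i j; under eq_fun do rewrite mxE.
by rewrite mxE; apply: cvgMr.
Qed.

Lemma entrywise_cvgB m n (A_ B_ : nat -> 'M[R]_(m, n)) A B :
  entrywise_cvg F A_ A -> entrywise_cvg F B_ B ->
  entrywise_cvg F (fun k => A_ k - B_ k) (A - B).
Proof.
move=> cA cB i j; under eq_fun do rewrite !mxE.
by rewrite !mxE; apply: cvgB.
Qed.

Lemma entrywise_cvgM m n q (A_ : nat -> 'M[R]_(m, n)) (B_ : nat -> 'M[R]_(n, q)) A B :
  entrywise_cvg F A_ A -> entrywise_cvg F B_ B ->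
  entrywise_cvg F (fun k => A_ k *m B_ k) (A *m B).
Proof.
move=> cA cB i j; under eq_fun do rewrite mxE.
rewrite mxE; apply: cvg_sumr => l; exact: cvgM.
Qed.

Lemma entrywise_cvgT m n (A_ : nat -> 'M[R]_(m, n)) A :
  entrywise_cvg F A_ A -> entrywise_cvg F (fun k => (A_ k)^T) A^T.
Proof.
move=> cA i j; under eq_fun do rewrite mxE.
by rewrite mxE; apply: cA.
Qed.

Lemma entrywise_cvg_unique m n (A_ : nat -> 'M[R]_(m, n)) A B :
  entrywise_cvg F A_ A -> entrywise_cvg F A_ B -> A = B.
Proof.
move=> cA cB; apply/matrixP => i j.
exact: (cvg_unique _ (cA i j) (cB i j)).
Qed.

Lemma cvg_frob_dot m n (A_ B_ : nat -> 'M[R]_(m, n)) A B :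
  entrywise_cvg F A_ A -> entrywise_cvg F B_ B ->
  frob_dot (A_ k) (B_ k) @[k --> F] --> frob_dot A B.
Proof.
move=> cA cB; under eq_fun do rewrite frob_dotE.
rewrite frob_dotE; apply: cvg_sumr => i; apply: cvg_sumr => j; exact: cvgM.
Qed.

Lemma entrywise_cvg_norm m n (A_ : nat -> 'M[R]_(m, n)) A :
  entrywise_cvg F A_ A <-> frob_norm (A_ k - A) @[k --> F] --> 0.
Proof.
split=> [cA | cN i j].
  have cAA := entrywise_cvgB cA (@entrywise_cvg_cst _ _ A).
  have := cvg_frob_dot cAA cAA; rewrite subrr frob_dot0r => c0.
  rewrite -[X in _ --> X](sqrtr0 R).
  by apply: continuous_cvg c0; exact: sqrt_continuous.
apply/cvgrPdist_le => e e0; move/cvgrPdist_le : cN => /(_ _ e0).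
apply: filterS => k; rewrite sub0r normrN ger0_norm ?frob_norm_ge0 //.
apply: le_trans; rewrite distrC; have := entry_le_frob_norm (A_ k - A) i j.
by rewrite !mxE.
Qed.

Lemma entrywise_cvg_gradient n (f : 'M[R]_n -> R) L (A_ : nat -> 'M[R]_n) A :
  gradient_lipschitz L f -> (forall k, A_ k \is symmetricmx) ->
  A \is symmetricmx -> entrywise_cvg F A_ A ->
  entrywise_cvg F (fun k => gradient f (A_ k)) (gradient f A).
Proof.
move=> lip symA_ symA /entrywise_cvg_norm cA; apply/entrywise_cvg_norm.
apply: (@squeeze_cvgr _ _ _ _ (fun=> 0) (fun k => L * frob_norm (A_ k - A))).
- by apply: nearW => k; rewrite frob_norm_ge0 lip.
- exact: cvg_cst.
- by rewrite -[X in _ --> X](mulr0 L); apply: cvgMr.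
Qed.

Lemma entrywise_cvg_cvg m n (A_ : nat -> 'M[R]_(m, n)) A :
  entrywise_cvg F A_ A -> A_ @ F --> A.
Proof.
move=> cA B [Q QA QB].
have QF i j : \forall k \near F, Q i j (A_ k i j) by exact: cA (QA i j).
have : \forall k \near F, forall i j, Q i j (A_ k i j).
  by apply: filter_forall => i; apply: filter_forall => j; exact: QF.
by apply: filterS => k; exact: QB.
Qed.

Lemma nbhs_entry m n (A : 'M[R]_(m, n)) i j (B : set R) :
  nbhs (A i j) B -> nbhs A [set M | B (M i j)].
Proof.
move=> AB; exists (fun i' j' => if (i' == i) && (j' == j) then B else setT).
  move=> i' j'; case: ifP => [/andP[/eqP-> /eqP->] // | _]; exact: filterT.
by move=> M /(_ i j); rewrite !eqxx.
Qed.

End EntrywiseConvergence.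

(** Compactness of the segment gives a cluster point, and an ultrafilter converges to each of its
    cluster points. *)
Lemma bounded_ultra_cvg (R : realType) (U : set_system nat) (u : nat -> R) (B : R) :
  UltraFilter U -> (forall k, `|u k| <= B) -> exists l : R, u @ U --> l.
Proof.
move=> UU uB; have inB : (u @ U) `[- B, B]%classic.
  by apply: (@filterE _ U) => k; rewrite /= in_itv /= -ler_norml.
have [l [_ cl]] := @segment_compact R (- B) B (u @ U) _ inB.
exists l => V nV; have [//|UnV] := in_ultra_setVsetC (u @^-1` V) UU.
by have [y [nVy Vy]] := cl (~` V) V UnV nV.
Qed.

(** * Existence of accumulation points and filters converging to them *)

Section AccumulationPoints.
Variables (R : realType) (n p : nat).
Variables (X : nat -> 'M[R]_(n, p)) (Y Lam : nat -> 'M[R]_n).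

(** Along one ultrafilter finer than [\oo] all bounded entries converge at once, so no successive
    extraction is needed. *)
Lemma accumulation_point_exists (B : R) :
  (forall k i j, `|X k.+1 i j| <= B) -> (forall k i j, `|Y k.+1 i j| <= B) ->
  (forall k i j, `|Lam k.+1 i j| <= B) ->
  exists Xs Ys Lams, accumulation_point X Y Lam Xs Ys Lams.
Proof.
move=> bX bY bL; have [U [UU sub]] := ultraFilterLemma (F := \oo) _.
have ultra_lim q (A_ : nat -> 'M[R]_(n, q)) :
    (forall k i j, `|A_ k i j| <= B) -> exists A : 'M[R]_(n, q), A_ @ U --> A.
  move=> A_B.
  have lim i j : exists l : R, A_ k i j @[k --> U] --> l.
    by apply: (bounded_ultra_cvg (B := B)) => k.
  exists (\matrix_(i, j) sval (cid (lim i j))).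
  by apply: entrywise_cvg_cvg => i j; rewrite mxE; exact: (svalP (cid (lim i j))).
have [Xs cX] := ultra_lim p (fun k => X k.+1) bX.
have [Ys cY] := ultra_lim n (fun k => Y k.+1) bY.
have [Lams cL] := ultra_lim n (fun k => Lam k.+1) bL.
exists Xs, Ys, Lams => A V nA nV.
have cV := cvg_pair (cvg_pair cX cY) cL.
have [|k [Ak Vk]] := @filter_ex _ U _ ((fun k => A (X k.+1, Y k.+1, Lam k.+1)) `&`
  (fun k => V (X k.+1, Y k.+1, Lam k.+1))).
  by apply: filterI; [exact: sub | exact: cV].
by exists (X k.+1, Y k.+1, Lam k.+1).
Qed.

(** The filter is generated by index tails intersected with preimages of neighborhoods of the point;
    clustering says exactly that these sets are nonempty. *)
Lemma accumulation_point_filter Xs Ys Lams :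
  accumulation_point X Y Lam Xs Ys Lams ->
  exists F : set_system nat, [/\ ProperFilter F, \oo `<=` F,
    entrywise_cvg F (fun k => X k.+1) Xs, entrywise_cvg F (fun k => Y k.+1) Ys
    & entrywise_cvg F (fun k => Lam k.+1) Lams].
Proof.
move=> acc; pose s k := (X k.+1, Y k.+1, Lam k.+1).
pose base (NV : nat * set ('M[R]_(n, p) * 'M[R]_n * 'M[R]_n)) :=
  [set k | (NV.1 <= k)%N /\ NV.2 (s k)].
pose F := filter_from [set NV | nbhs (Xs, Ys, Lams) NV.2] base.
have FN V : nbhs (Xs, Ys, Lams) V -> F (s @^-1` V).
  by move=> nV; exists (0%N, V) => // k [].
have PF : ProperFilter F.
  apply: filter_from_proper; last first.
    move=> [N V] /= nV.
    have [|_ [[k Nk <-] Vk]] := acc (s @` [set k | (N <= k)%N]) V _ nV.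
      by exists N => // k Nk; exists k.
    by exists k.
  apply: filter_from_filter; first by exists (0%N, setT); exact: filterT.
  move=> [N V] [N' V'] /= nV nV'; exists (maxn N N', V `&` V').
    exact: filterI.
  by move=> k [/=]; rewrite geq_max => /andP[? ?] [? ?].
exists F; split=> //.
- move=> A [N _ NA]; exists (N, setT); first exact: filterT.
  by move=> k [Nk _]; exact: NA.
- move=> i j B nB; suff : F (s @^-1` [set M : 'M[R]_(n, p) * 'M[R]_n * 'M[R]_n | B (M.1.1 i j)]) by [].
  apply: FN; have nXY := @cvg_fst _ _ (nbhs Xs) (nbhs Ys) (nbhs_filter Ys) _ (nbhs_entry nB).
  exact: (@cvg_fst _ _ (nbhs (Xs, Ys)) (nbhs Lams) (nbhs_filter Lams) _ nXY).
- move=> i j B nB; suff : F (s @^-1` [set M : 'M[R]_(n, p) * 'M[R]_n * 'M[R]_n | B (M.1.2 i j)]) by [].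
  apply: FN; have nXY := @cvg_snd _ _ (nbhs Xs) (nbhs Ys) (nbhs_filter Xs) _ (nbhs_entry nB).
  exact: (@cvg_fst _ _ (nbhs (Xs, Ys)) (nbhs Lams) (nbhs_filter Lams) _ nXY).
- move=> i j B nB; suff : F (s @^-1` [set M : 'M[R]_(n, p) * 'M[R]_n * 'M[R]_n | B (M.2 i j)]) by [].
  apply: FN.
  exact: (@cvg_snd _ _ (nbhs (Xs, Ys)) (nbhs Lams) (nbhs_filter (Xs, Ys)) _ (nbhs_entry nB)).
Qed.

End AccumulationPoints.

(** [F X] is [(grad f(P) - grad f(Y)) X - A X + beta X]. Commutation gives [A X = X (X^T A X)], so
    the last two terms equal [X Sigma], and the Lipschitz bound handles the rest. *)
Lemma first_order_residual (R : realType) (n p m : nat) (f : 'M[R]_n -> R)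
    (W : 'I_m -> 'M[R]_n) (beta s L : R) (Xs : 'M[R]_(n, p)) (Ys Lams : 'M[R]_n)
    (nu : 'cV[R]_m) :
  gradient_lipschitz L f -> Ys \is symmetricmx -> Lams \is symmetricmx ->
  stiefel Xs ->
  gradient f Ys + s *: Lams + beta *: (Ys - Xs *m Xs^T)
    = \sum_j nu j 0 *: W j ->
  (beta *: Ys + s *: Lams) *m (Xs *m Xs^T)
    = (Xs *m Xs^T) *m (beta *: Ys + s *: Lams) ->
  let Sigma := beta%:M - Xs^T *m (beta *: Ys + s *: Lams) *m Xs in
  Sigma \is symmetricmx /\
  frob_norm (F_mx f W Xs (- nu) *m Xs - Xs *m Sigma)
    <= L * frob_norm (Ys - Xs *m Xs^T).
Proof.
move=> lip symY symL sX gradE comm; set A := beta *: Ys + s *: Lams in comm *.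
have symA : A^T = A by rewrite sym_trmx // symD ?symZ.
move=> Sigma; split.
  by rewrite symmetricmxE /Sigma linearB /= tr_scalar_mx !trmx_mul trmxK symA mulmxA.
have -> : F_mx f W Xs (- nu) *m Xs - Xs *m Sigma =
    (gradient f (Xs *m Xs^T) - gradient f Ys) *m Xs.
  have AX : Xs *m (Xs^T *m A *m Xs) = A *m Xs.
    by rewrite !mulmxA -comm -!mulmxA sX mulmx1.
  have -> : F_mx f W Xs (- nu) =
      gradient f (Xs *m Xs^T) - gradient f Ys - A + beta *: (Xs *m Xs^T).
    rewrite /F_mx (_ : \sum_j (- nu) j 0 *: W j = - \sum_j nu j 0 *: W j).
      rewrite -gradE /A scalerBr; apply/matrixP => i j; rewrite !mxE; ring.
    by rewrite -sumrN; apply: eq_bigr => j _; rewrite mxE scaleNr.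
  rewrite /Sigma mulmxBr AX mul_mx_scalar; clearbody A; move: (gradient f (Xs *m Xs^T) - _) => D.
  rewrite mulmxDl mulmxBl -scalemxAl -(mulmxA Xs) sX mulmx1 opprB.
  by rewrite -addrA [beta *: Xs + _]addrC subrK subrK.
apply: le_trans (frob_norm_mul_stiefel _ sX) _.
by rewrite -frob_normN opprB; apply: lip => //; exact: gram_sym.
Qed.

(** * Passage to the limit and the final bounds *)

Theorem theorem3p1 (R : realType) (n p m : nat)
    (hp : (1 <= p)%N) (hpn : (p < n)%N)
    (f : 'M[R]_n -> R) (W : 'I_m -> 'M[R]_n) (b : 'I_m -> R)
    (hW : forall j, W j \is symmetricmx)
    (hP : standing_assumption p f W b)
    (beta tau delta : R) (etas : nat -> R)
    (X : nat -> 'M[R]_(n, p)) (Y Lam : nat -> 'M[R]_n)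
    (halg : DASSP f W b beta tau delta etas X Y Lam)
    (hdelta : 0 < delta < 1)
    (c : R) (hc : 2 * (1 - delta) * (2 - delta) / delta < c)
    (L : R) (hL : 0 < L)
    (hA1_diff : continuously_differentiable f)
    (hA1_lip : gradient_lipschitz L f)
    (gamma : R) (hgamma : 0 < gamma)
    (hA2 : forall k, gamma <= lambda p (A_mx beta delta Y Lam k)
                              - lambda p.+1 (A_mx beta delta Y Lam k))
    (hA3 : 2 * (L + 1) < beta)
    (eta : R) (hA4_const : forall k, etas k = eta)
    (hA4 : 0 < eta < 2 / (beta + L))
    (hA5 : 0 < tau < delta / (2 * c)
                     * Num.min (1 / beta * (1 / eta - (beta + L) / 2))
                               (gamma / n%:R)) :
  (exists Xs Ys Lams, accumulation_point X Y Lam Xs Ys Lams) /\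
  forall Xs Ys Lams, accumulation_point X Y Lam Xs Ys Lams ->
    exists (Sigma : 'M[R]_p) (mu : 'cV[R]_m),
      [/\ Sigma \is symmetricmx,
          frob_norm (F_mx f W Xs mu *m Xs - Xs *m Sigma)
            <= C1_hat p L tau beta Lams * delta
        & \big[Num.max/0]_(j < m) `|\tr (Xs^T *m W j *m Xs) - b j|
            <= C2_hat W tau beta Lams * delta].
Proof.
have [B bnd] := iterates_bounded hp hpn hW halg hdelta hc hL hA1_diff hA1_lip
  hgamma hA2 hA3 hA4_const hA4 hA5.
have [dY dLam] := successive_differences_cvg0 hp hpn hW halg hdelta hc hL
  hA1_diff hA1_lip hgamma hA2 hA3 hA4_const hA4 hA5.
split.
  by apply: (accumulation_point_exists (B := B)) => k; have [] := bnd k.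
move=> Xs Ys Lams /accumulation_point_filter[F [PF Foo cX cY cL]].
have symY k := Y_sym hW halg hA1_diff k.
have symL k := Lam_sym hW halg hA1_diff k.
have affY k : affine_set W b (Y k) by have [] := iterates_sym hW halg hA1_diff k.
have beta0 := dassp_beta halg; have /andP[tau0 _] := dassp_tau halg.
have /andP[delta0 _] := hdelta.
(* The updates involve indices [k] and [k.+1], while accumulation concerns only [k.+1]; vanishing
   differences give both the same limit. *)
have cvg_prev (Z : nat -> 'M[R]_n) Zs : frob_norm (Z k.+1 - Z k) @[k --> \oo] --> 0 ->
    entrywise_cvg F (fun k => Z k.+1) Zs -> entrywise_cvg F Z Zs.
  move=> dZ cZ.
  have c0 : entrywise_cvg F (fun k => Z k.+1 - Z k) 0.
    apply/(entrywise_cvg_norm PF); under eq_fun do rewrite subr0.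
    by apply: cvg_trans dZ; exact: cvg_app.
  have := entrywise_cvgB PF cZ c0; rewrite subr0.
  have -> : (fun k => Z k.+1 - (Z k.+1 - Z k)) = Z; last by [].
  by apply/funext => k; rewrite opprB addrC subrK.
have dY' : frob_norm (Y k.+1 - Y k) @[k --> \oo] --> 0.
  by rewrite -cvg_shiftS.
have cY' := cvg_prev _ _ dY' cY; have cL' := cvg_prev _ _ dLam cL.
have limit_sym (Z : nat -> 'M[R]_n) Zs : (forall k, Z k \is symmetricmx) ->
    entrywise_cvg F Z Zs -> Zs \is symmetricmx.
  move=> symZ cZ; rewrite symmetricmxE; apply/eqP.
  apply: (entrywise_cvg_unique PF (entrywise_cvgT cZ)).
  by under eq_fun do rewrite sym_trmx //.
have symYs := limit_sym _ _ symY cY'; have symLs := limit_sym _ _ symL cL'.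
have cP := entrywise_cvgM PF cX (entrywise_cvgT cX).
have sXs : stiefel Xs.
  apply: (entrywise_cvg_unique PF (entrywise_cvgM PF (entrywise_cvgT cX) cX)).
  under eq_fun do rewrite (X_stiefel halg).
  exact: entrywise_cvg_cst.
have cR := entrywise_cvgB PF cY cP.
(* The limit of the multiplier update, with the same [Lams] on both sides. *)
have resE : Ys - Xs *m Xs^T = (delta / (tau * beta)) *: Lams.
  have := entrywise_cvgD PF (entrywise_cvgZ PF (a := 1 - delta) cL') (entrywise_cvgZ PF (a := tau * beta) cR).
  under eq_fun do rewrite -(dassp_Lam halg).
  move=> /(entrywise_cvg_unique PF cL) LE.
  rewrite mulrC -scalerA (_ : delta *: Lams = (tau * beta) *: (Ys - Xs *m Xs^T)).
    by rewrite scalerA mulVf ?scale1r // mulf_neq0 ?gt_eqF.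
  rewrite -[RHS](addKr ((1 - delta) *: Lams)) -LE addrC -[X in X - _]scale1r.
  by rewrite -scalerBl opprB addrC subrK.
pose s := 1 - delta.
pose G k := gradient f (Y k) + s *: Lam k + beta *: (Y k - X k.+1 *m (X k.+1)^T).
pose Gs := gradient f Ys + s *: Lams + beta *: (Ys - Xs *m Xs^T).
have cG : entrywise_cvg F G Gs.
  have cgrad := entrywise_cvg_gradient PF hA1_lip symY symYs cY'.
  have := entrywise_cvgD PF (entrywise_cvgD PF cgrad (entrywise_cvgZ PF (a := s) cL'))
    (entrywise_cvgZ PF (a := beta) (entrywise_cvgB PF cY' cP)).
  exact: id.
have eta0 : 0 < eta by have /andP[] := hA4.
(* For tangent [Z], [<G k, Z>] equals [<Y k - Y k.+1, Z> / eta] by the Y-step, and this tends to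
   0. *)
have orthG Z : tangent_set W Z -> frob_dot Gs Z = 0.
  move=> tZ.
  have c1 := cvg_frob_dot PF cG (entrywise_cvg_cst PF (A := Z)).
  have cD := cvg_frob_dot PF (entrywise_cvgZ PF (a := eta^-1) (entrywise_cvgB PF cY' cY))
    (entrywise_cvg_cst PF (A := Z)).
  rewrite subrr scaler0 frob_dotC frob_dot0r in cD.
  suff GD : (fun k => frob_dot (G k) Z) =
      (fun k => frob_dot (eta^-1 *: (Y k - Y k.+1)) Z).
    by rewrite GD in c1; exact: (cvg_unique _ c1 cD).
  apply/funext => k; have [_ _ symG] := iterates_sym hW halg hA1_diff k.
  have [_ orth] := proj_tangentP hW symG.
  have := orth Z tZ; rewrite frob_dotDl frob_dotNl => /eqP.
  rewrite subr_eq0 => /eqP; rewrite -/s -/(G k) => ->.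
  rewrite (dassp_Y halg) hA4_const opprB addrC subrK scalerA mulVf ?gt_eqF //.
  by rewrite scale1r.
have symGs : Gs \is symmetricmx.
  by apply: limit_sym cG => k; have [] := iterates_sym hW halg hA1_diff k.
have [nu GsE] := orth_tangent_span hW symGs orthG.
pose As := Ys + ((1 - delta) / beta) *: Lams.
have cA : entrywise_cvg F (A_mx beta delta Y Lam) As.
  have := entrywise_cvgD PF cY' (entrywise_cvgZ PF (a := (1 - delta) / beta) cL').
  exact: id.
have comm : As *m (Xs *m Xs^T) = (Xs *m Xs^T) *m As.
  apply: (entrywise_cvg_unique PF (entrywise_cvgM PF cA cP)).
  have := entrywise_cvgM PF cP cA.
  by under eq_fun do rewrite -(X_step_gap hp hpn hW halg hA1_diff hgamma hA2 _).1.
have AsE : beta *: Ys + s *: Lams = beta *: As.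
  by rewrite /As scalerDr scalerA mulrC divfK ?gt_eqF.
have [|symS resS] := first_order_residual hA1_lip symYs symLs sXs GsE.
  by rewrite AsE -scalemxAl -scalemxAr comm.
have norm_res : frob_norm (Ys - Xs *m Xs^T) = delta / (tau * beta) * frob_norm Lams.
  by rewrite resE frob_normZ gtr0_norm // divr_gt0 ?mulr_gt0.
have q0 : 0 <= delta / (tau * beta) * frob_norm Lams.
  by rewrite mulr_ge0 ?frob_norm_ge0 // divr_ge0 ?mulr_ge0 // ltW.
exists (beta%:M - Xs^T *m (beta *: Ys + s *: Lams) *m Xs), (- nu); split=> //.
- apply: le_trans resS _; rewrite norm_res.
  have -> : C1_hat p L tau beta Lams * delta =
      Num.sqrt (p * (n - p))%:R * (L * (delta / (tau * beta) * frob_norm Lams)).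
    by rewrite /C1_hat; ring.
  (* The factor [sqrt (p (n - p))] is at least 1, as [p] and [n - p] are positive. *)
  rewrite ler_peMl ?(mulr_ge0 (ltW hL) q0) //.
  by rewrite -[X in X <= _]sqrtr1 ler_sqrt // ler1n muln_gt0 hp subn_gt0.
- have -> : C2_hat W tau beta Lams * delta =
      \big[Num.max/0]_(j < m) frob_norm (W j) * (delta / (tau * beta) * frob_norm Lams).
    by rewrite /C2_hat; ring.
  rewrite -norm_res in q0 *.
  apply: bigmax_le => [|j _]; first by rewrite mulr_ge0 // bigmax_ge_id.
  (* [Ys] satisfies the affine constraints as a limit of the [Y k], so the defect of [Xs] comes only
     from [Ys - Xs Xs^T]. *)
  have -> : \tr (Xs^T *m W j *m Xs) - b j = - frob_dot (W j) (Ys - Xs *m Xs^T).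
    have bE : frob_dot (W j) Ys = b j.
      have c1 := cvg_frob_dot PF (entrywise_cvg_cst PF (A := W j)) cY'.
      have bE : (fun k => frob_dot (W j) (Y k)) = (fun=> b j).
        by apply/funext => k; rewrite /frob_dot sym_trmx //; have [_ ->] := affY k.
      by rewrite bE in c1; exact: (cvg_unique _ c1 (cvg_cst (b j))).
    by rewrite frob_dotDr frob_dotNr bE frob_dot_gram sym_trmx // opprB.
  rewrite normrN; apply: le_trans (frob_dot_norm_le _ _) _.
  by rewrite ler_wpM2r //; exact: le_bigmax.
Qed.
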